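(* Let $p$ be a homogeneous polynomial of degree $n$ in $m$ real variables which is hyperbolic in the direction $e\in\mathbb{R}^m$, with $p(e)>0$. Let $\mathbf{X}=(x_1,\dots,x_n)$, $x_i\in\mathbb{R}^m$, be an $n$-tuple of $e$-nonnegative vectors. Then the $p$-mixed form $M_p(x_1,\dots,x_n)$ is positive if and only if $$\operatorname{Rank}_p\Big(\sum_{i\in S}x_i\Big)\ \ge\ |S|\qquad\text{for all } S\subseteq\{1,2,\dots,n\}.$$
   Context: A homogeneous polynomial $p(x)$, $x\in\mathbb{R}^m$, of degree $n$ is hyperbolic in the direction $e\in\mathbb{R}^m$ if for every $x\in\mathbb{R}^m$ the univariate polynomial $\lambda\mapsto p(x-\lambda e)$ has exactly $n$ real roots counting multiplicities; denote them $\lambda_1(x)\ge\dots\ge\lambda_n(x)$. A vector $x$ is $e$-nonnegative if $\lambda_n(x)\ge 0$ and $e$-positive if $\lambda_n(x)>0$. The $p$-rank of $x$ is $\operatorname{Rank}_p(x)=|\{i:\lambda_i(x)\neq 0\}|$ (number of nonzero roots counted with multiplicity). The $p$-mixed form of $(x_1,\dots,x_n)$ is $M_p(x_1,\dots,x_n)=\frac{\partial^n}{\partial\alpha_1\cdots\partial\alpha_n}\,p\big(\sum_{i=1}^n\alpha_i x_i\big)$. *)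

(* Defs.v *)
From HB Require Import structures.
From mathcomp Require Import all_boot all_order all_algebra.
From mathcomp Require Import reals polyrcf mpoly.

Set Implicit Arguments.
Unset Strict Implicit.
Unset Printing Implicit Defensive.

Import Order.TTheory GRing.Theory Num.Theory.

Local Open Scope ring_scope.

(* The univariate polynomial t |-> p (x - t e). *)
Definition line_poly (R : realType) (m : nat) (p : {mpoly R[m]})
    (e x : 'rV[R]_m) : {poly R} :=
  mmap polyC (fun j : 'I_m => (x ord0 j)%:P - e ord0 j *: 'X) p.

(* [rootsR q] lists the distinct real roots of [q] and is empty when [q = 0]. *)
Definition roots_mult (R : realType) (q : {poly R}) : seq R :=
  sort (fun a b => b <= a) (flatten [seq nseq (mup a q) a | a <- rootsR q]).

(* The zero polynomial is excluded explicitly, because [roots_mult 0 = [::]]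
   would otherwise pass for "exactly 0 roots" when [n = 0]. *)
Definition hyperbolic (R : realType) (m n : nat) (p : {mpoly R[m]})
    (e : 'rV[R]_m) : Prop :=
  forall x : 'rV[R]_m,
    line_poly p e x != 0 /\ size (roots_mult (line_poly p e x)) = n.

(* Indices are shifted: [lambda p e x k] is the (k+1)-st largest root, so that
   lambda_1, ..., lambda_n are the values at k = 0, ..., n - 1. *)
Definition lambda (R : realType) (m : nat) (p : {mpoly R[m]})
    (e x : 'rV[R]_m) (k : nat) : R :=
  nth 0 (roots_mult (line_poly p e x)) k.

(* When [n = 0] there is no lambda_n; the default value 0 of [lambda] makes the
   condition hold, as it should for an empty family of roots. *)
Definition e_nonnegative (R : realType) (m n : nat) (p : {mpoly R[m]})
    (e x : 'rV[R]_m) : Prop :=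
  0 <= lambda p e x n.-1.

Definition p_rank (R : realType) (m n : nat) (p : {mpoly R[m]})
    (e x : 'rV[R]_m) : nat :=
  #|[set i : 'I_n | lambda p e x i != 0]|.

(* p (\sum_i alpha_i x_i) as a polynomial in alpha_1, ..., alpha_n. *)
Definition pencil (R : realType) (m n : nat) (p : {mpoly R[m]})
    (x : 'I_n -> 'rV[R]_m) : {mpoly R[n]} :=
  p \mPo [tuple \sum_(i < n) x i ord0 j *: 'X_i | j < m].

(* For [p] homogeneous of degree [n] the derivative is a constant polynomial, so
   the point of evaluation is immaterial. *)
Definition mixed_form (R : realType) (m n : nat) (p : {mpoly R[m]})
    (x : 'I_n -> 'rV[R]_m) : R :=
  ((pencil p x)^`M[ [multinom 1%N | i < n] ]).@[fun _ => 0].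

(* Main.v *)
Require Import Defs.
From HB Require Import structures.
From mathcomp Require Import all_boot all_order all_algebra.
From mathcomp Require Import boolp classical_sets reals complex polyrcf mpoly.
From mathcomp Require Import zify ring lra.

(** Helton-Vinnikov is avoided: only Gårding's theory of hyperbolic polynomials
    and a capacity argument of Gurvits are used.

    Gårding. If a is e-positive, the complex roots w of p (x + i u e + w a),
    u > 0, never cross the real axis as x varies, so they stay in the lower half
    plane and p is hyperbolic in direction a. When p x <> 0, the number of
    positive eigenvalues of x is the same for e and for a: along the segment
    from e to a the eigenvalues move continuously and never vanish. It follows
    that every ordered eigenvalue is monotone in e-nonnegative directions.

    Capacity. Let all x_i be e-positive and q(alpha) = p (sum alpha_i x_i).
    Replacing q by the derivative in its last variable at 0 preserves
    hyperbolicity (Gauss-Lucas) and changes the best c in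
    q(alpha) >= c prod alpha_i by a bounded factor, since q is real-rooted in
    that variable. Hence M_p prod alpha_i <= q(alpha), and M_p >= c / K_n for a
    constant K_n. Both statements extend to e-nonnegative x_i by perturbation.

    If all ranks are large enough, sort alpha decreasingly; the k-th eigenvalue
    of sum alpha_i x_i is at least alpha_k times the k-th eigenvalue of
    x_1 + ... + x_k, which is positive, so c > 0. Conversely, giving weight T to
    the indices in S and 1 to the others yields M_p T^|S| <= O(T^r) with r the
    rank of sum_(i in S) x_i. *)

Set Implicit Arguments.
Unset Strict Implicit.
Unset Printing Implicit Defensive.

Import Order.TTheory GRing.Theory Num.Theory.

Local Open Scope ring_scope.

(** * Continuity of roots *)

(** Covers the real absolute value and the complex modulus [Normc.normc] at once: continuity of
    roots is needed for complex roots in the lower half plane and for real eigenvalues. *)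
Record absolute_value (R : realType) (K : fieldType) (N : K -> R) : Prop :=
  AbsoluteValue {
    absv_ge0 : forall x, 0 <= N x;
    absv0 : N 0 = 0;
    absv1 : N 1 = 1;
    absvN : forall x, N (- x) = N x;
    absvM : forall x y, N (x * y) = N x * N y;
    absvD : forall x y, N (x + y) <= N x + N y }.

Lemma absolute_value_normr (R : realType) :
  absolute_value (Num.norm : R -> R).
Proof.
split=> [x||||x y|x y]; rewrite ?normr_ge0 ?normr0 ?normr1 //.
- by move=> x; rewrite normrN.
- by rewrite normrM.
- exact: ler_normD.
Qed.

Lemma absolute_value_normc (R : realType) :
  absolute_value (@Normc.normc R).
Proof.
split=> [x||||x y|x y].
- by case: x => a b; rewrite sqrtr_ge0.
- exact: Normc.normc0.
- exact: Normc.normc1.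
- exact: normcN.
- exact: Normc.normcM.
- exact: le_normcD.
Qed.

Definition cont (R : realType) (K : fieldType) (N : K -> R) (f : R -> K) :=
  forall x eps, 0 < eps ->
    exists2 d, 0 < d & forall y, `|y - x| < d -> N (f y - f x) < eps.

Section Continuity.
Variables (R : realType) (K : fieldType) (N : K -> R).
Hypothesis hN : absolute_value N.
Implicit Types f g : R -> K.

Lemma absvB x y : N (x - y) = N (y - x).
Proof. by rewrite -(absvN hN) opprB. Qed.

Lemma absv_sum (I : Type) (r : seq I) (F : I -> K) :
  N (\sum_(i <- r) F i) <= \sum_(i <- r) N (F i).
Proof.
elim: r => [|i r IH]; first by rewrite !big_nil (absv0 hN).
by rewrite !big_cons (le_trans (absvD hN _ _)) // lerD2l.
Qed.

Lemma absvX x n : N (x ^+ n) = N x ^+ n.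
Proof. by elim: n => [|n IH]; rewrite ?(absv1 hN) // !exprS (absvM hN) IH. Qed.

Lemma absv_prod (I : Type) (r : seq I) (F : I -> K) :
  N (\prod_(i <- r) F i) = \prod_(i <- r) N (F i).
Proof.
elim: r => [|i r IH]; first by rewrite !big_nil (absv1 hN).
by rewrite !big_cons (absvM hN) IH.
Qed.

Lemma eq_cont f g : f =1 g -> cont N f -> cont N g.
Proof. by move=> /funext ->. Qed.

Lemma cont_cst c : cont N (fun=> c).
Proof. by move=> x eps e0; exists 1 => // y _; rewrite subrr (absv0 hN). Qed.

Lemma contD f g : cont N f -> cont N g -> cont N (fun t => f t + g t).
Proof.
move=> cf cg x eps e0.
have e2 : 0 < eps / 2 by lra.
have [d d0 fd] := cf x _ e2; have [d' d'0 gd] := cg x _ e2.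
exists (Num.min d d'); first by rewrite lt_min d0.
move=> y; rewrite lt_min => /andP[/fd h1 /gd h2].
rewrite opprD addrACA; apply: le_lt_trans (absvD hN _ _) _; lra.
Qed.

Lemma contM f g : cont N f -> cont N g -> cont N (fun t => f t * g t).
Proof.
move=> cf cg x eps e0.
set A := N (f x) + 1; set B := N (g x) + 1.
have A0 : 0 < A by rewrite /A; have := absv_ge0 hN (f x); lra.
have B0 : 0 < B by rewrite /B; have := absv_ge0 hN (g x); lra.
have [d1 d10 f1] := cf x 1 ltr01.
have [d2 d20 f2] := cf x (eps / 2 / B) ltac:(by rewrite !divr_gt0).
have [d3 d30 g3] := cg x (eps / 2 / A) ltac:(by rewrite !divr_gt0).
exists (Num.min d1 (Num.min d2 d3)); first by rewrite !lt_min d10 d20.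
move=> y; rewrite !lt_min => /and3P[/f1 h1 /f2 h2 /g3 h3].
have -> : f y * g y - f x * g x = f y * (g y - g x) + (f y - f x) * g x by ring.
apply: le_lt_trans (absvD hN _ _) _; rewrite !(absvM hN).
have hA : N (f y) <= A.
  have -> : f y = f x + (f y - f x) by ring.
  by apply: le_trans (absvD hN _ _) _; rewrite lerD2l ltW.
have hB : N (g x) <= B by rewrite /B; lra.
have k1 : N (f y) * N (g y - g x) < eps / 2.
  apply: le_lt_trans (_ : A * N (g y - g x) < _).
    by apply: ler_wpM2r => //; apply: absv_ge0 hN _.
  by rewrite mulrC -ltr_pdivlMr.
have k2 : N (f y - f x) * N (g x) < eps / 2.
  apply: le_lt_trans (_ : N (f y - f x) * B < _).
    by apply: ler_wpM2l => //; apply: absv_ge0 hN _.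
  by rewrite -ltr_pdivlMr.
lra.
Qed.

Lemma contX f n : cont N f -> cont N (fun t => f t ^+ n).
Proof.
move=> cf; elim: n => [|n IH]; first exact: cont_cst.
by apply: eq_cont (contM cf IH) => t; rewrite exprS.
Qed.

Lemma cont_sum (I : Type) (r : seq I) (P : pred I) (F : I -> R -> K) :
  (forall i, cont N (F i)) -> cont N (fun t => \sum_(i <- r | P i) F i t).
Proof.
move=> cF; elim: r => [|i r IH].
  by apply: eq_cont (cont_cst 0) => t; rewrite big_nil.
case Pi: (P i); last by apply: eq_cont IH => t; rewrite big_cons Pi.
by apply: eq_cont (contD (cF i) IH) => t; rewrite big_cons Pi.
Qed.

Lemma cont_absv f : cont N f -> cont (Num.norm : R -> R) (fun t => N (f t)).
Proof.
move=> cf x eps e0; have [d d0 fd] := cf x _ e0; exists d => // y /fd.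
apply: le_lt_trans; rewrite ler_norml; apply/andP; split.
  have := absvD hN (f x - f y) (f y).
  by rewrite subrK absvB; lra.
by have := absvD hN (f y - f x) (f x); rewrite subrK; lra.
Qed.

End Continuity.

Lemma cont_real_complex (R : realType) (f : R -> R) :
  cont Num.norm f -> cont (@Normc.normc R) (fun t => real_complex R (f t)).
Proof.
move=> cf x eps e0; have [d d0 fd] := cf x _ e0; exists d => // y /fd.
by rewrite -rmorphB /= expr0n addr0 sqrtr_sqr.
Qed.

(** Intermediate value theorem. At the supremum of the points of [0, 1] where f is positive,
    continuity is incompatible with either sign of f. *)
Lemma cont_sign (R : realType) (f : R -> R) :
  cont Num.norm f -> (forall t, f t != 0) -> (0 < f 0) = (0 < f 1).
Proof.
move=> cf f0.
wlog f00 : f cf f0 / 0 < f 0.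
  move=> H; have [f00|f00] := ltP 0 (f 0); first by rewrite -(H f) // f00.
  have fN : 0 < - f 0 by rewrite oppr_gt0 lt_neqAle f0 f00.
  have cN : cont Num.norm (fun t => - f t).
    move=> x eps e0; have [d d0 fd] := cf x _ e0; exists d => // y /fd.
    by rewrite -opprD normrN.
  have Nf0 t : - f t != 0 by rewrite oppr_eq0.
  by have := H _ cN Nf0 fN; rewrite fN oppr_gt0 => /esym /ltW f1; rewrite ltNge f1.
rewrite f00; apply/esym; rewrite ltNge; apply/negP => f1.
have {}f1 : f 1 < 0 by rewrite lt_neqAle f1 f0.
pose S := [set t : R | 0 <= t <= 1 /\ 0 < f t]%classic.
have S0 : S 0 by rewrite /S /= lexx ler01.
have supS : has_sup S by split; [exists 0|exists 1 => t [/andP[]]].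
set x := sup S.
have x1 : x <= 1 by apply: ge_sup; [exists 0|move=> t [/andP[]]].
have x0 : 0 <= x by apply: ub_le_sup S0; case: supS.
have [fx|fx|fx] := ltgtP 0 (f x).
- have [d d0 fd] := cf x _ fx.
  have xlt1 : x < 1.
    rewrite lt_neqAle x1 andbT; apply/eqP => xe; move: fx; rewrite xe; lra.
  pose y := x + Num.min (d / 2) (1 - x).
  have m0 : 0 < Num.min (d / 2) (1 - x) by rewrite lt_min; apply/andP; split; lra.
  have md : Num.min (d / 2) (1 - x) <= d / 2 by rewrite ge_min lexx.
  have m1 : Num.min (d / 2) (1 - x) <= 1 - x by rewrite ge_min lexx orbT.
  have : `|y - x| < d by rewrite /y addrC addKr gtr0_norm //; lra.
  move=> /fd; rewrite ltr_norml => /andP[h _].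
  have Sy : S y by split; [apply/andP; split; rewrite /y; lra|lra].
  have : y <= x by apply: ub_le_sup Sy; case: supS.
  rewrite /y; lra.
- have fx' : 0 < - f x by rewrite oppr_gt0.
  have [d d0 fd] := cf x _ fx'.
  have [t [t01 ft] xt] := sup_adherent d0 supS.
  have tx : t <= x by apply: (ub_le_sup (proj2 supS)); split.
  have : `|t - x| < d by rewrite distrC ger0_norm; rewrite -/x in xt; lra.
  by move=> /fd; rewrite ltr_norml => /andP[_]; lra.
- by have := f0 x; rewrite -fx eqxx.
Qed.

Definition cont_poly (R : realType) (K : fieldType) (N : K -> R)
    (F : R -> {poly K}) :=
  forall i, cont N (fun t => (F t)`_i).

Section RootContinuity.
Variables (R : realType) (K : fieldType) (N : K -> R).
Hypothesis hN : absolute_value N.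
Implicit Types F G : R -> {poly K}.

Lemma eq_cont_poly F G : F =1 G -> cont_poly N F -> cont_poly N G.
Proof. by move=> /funext ->. Qed.

Lemma cont_poly_cst p : cont_poly N (fun=> p).
Proof. by move=> i; apply: cont_cst. Qed.

Lemma cont_polyD F G :
  cont_poly N F -> cont_poly N G -> cont_poly N (fun t => F t + G t).
Proof.
by move=> cF cG i; apply: eq_cont (contD hN (cF i) (cG i)) => t; rewrite coefD.
Qed.

Lemma cont_polyM F G :
  cont_poly N F -> cont_poly N G -> cont_poly N (fun t => F t * G t).
Proof.
move=> cF cG i.
apply: eq_cont (_ : cont N (fun t => \sum_(j < i.+1) (F t)`_j * (G t)`_(i - j))).
  by move=> t; rewrite coefM.
by apply: (cont_sum hN) => j; apply: (contM hN).
Qed.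

Lemma cont_polyX F n : cont_poly N F -> cont_poly N (fun t => F t ^+ n).
Proof.
move=> cF; elim: n => [|n IH]; first exact: cont_poly_cst.
by apply: eq_cont_poly (cont_polyM cF IH) => t; rewrite exprS.
Qed.

Lemma cont_polyC f : cont N f -> cont_poly N (fun t => (f t)%:P).
Proof.
move=> cf [|i]; first by apply: eq_cont cf => t; rewrite coefC.
by apply: eq_cont (cont_cst hN 0) => t; rewrite coefC.
Qed.

Lemma cont_poly_sum (I : Type) (r : seq I) (F : I -> R -> {poly K}) :
  (forall i, cont_poly N (F i)) -> cont_poly N (fun t => \sum_(i <- r) F i t).
Proof.
move=> cF; elim: r => [|i r IH].
  by apply: eq_cont_poly (cont_poly_cst 0) => t; rewrite big_nil.
by apply: eq_cont_poly (cont_polyD (cF i) IH) => t; rewrite big_cons.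
Qed.

Lemma cont_poly_prod (I : Type) (r : seq I) (F : I -> R -> {poly K}) :
  (forall i, cont_poly N (F i)) -> cont_poly N (fun t => \prod_(i <- r) F i t).
Proof.
move=> cF; elim: r => [|i r IH].
  by apply: eq_cont_poly (cont_poly_cst 1) => t; rewrite big_nil.
by apply: eq_cont_poly (cont_polyM (cF i) IH) => t; rewrite big_cons.
Qed.

Lemma horner_prod_XsubC (s : seq K) w :
  (\prod_(z <- s) ('X - z%:P)).[w] = \prod_(z <- s) (w - z).
Proof.
by elim: s => [|z s IH]; rewrite ?big_nil ?hornerC // !big_cons hornerM IH !hornerE.
Qed.

Lemma near_root (s : seq K) w eps : 0 < eps ->
  N (\prod_(z <- s) ('X - z%:P)).[w] < eps ^+ size s ->
  exists2 z, z \in s & N (w - z) < eps.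
Proof.
move=> e0; rewrite horner_prod_XsubC (absv_prod hN).
elim: s => [|z s IH]; first by rewrite big_nil ltxx.
rewrite big_cons /= exprS; have [h _|h] := ltP (N (w - z)) eps.
  by exists z; rewrite ?mem_head.
move=> lt; have [|y ys hy] := IH; last by exists y; rewrite ?inE ?ys ?orbT.
rewrite ltNge; apply/negP => le; move: lt; rewrite ltNge => /negP; apply.
by apply: ler_pM => //; rewrite ?exprn_ge0 ?ltW.
Qed.

(** Cauchy's bound: if [N z > 1], the equation bounds [N z ^ n] by the sum of the lower coefficients
    times [N z ^ n.-1]. *)
Lemma monic_root_bound (f : {poly K}) n z : size f = n.+1 -> f`_n = 1 ->
  f.[z] = 0 -> N z <= 1 + \sum_(i < n) N f`_i.
Proof.
move=> sf fn; have S0 : 0 <= \sum_(i < n) N f`_i.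
  by apply: sumr_ge0 => i _; apply: absv_ge0.
rewrite horner_coef sf big_ord_recr /= fn mul1r => /eqP.
rewrite addr_eq0 => /eqP e; have [z1|z1] := leP (N z) 1; first by lra.
have {}e : N z ^+ n = N (\sum_(i < n) f`_i * z ^+ i).
  by rewrite e (absvN hN) (absvX hN).
case: n e S0 {sf fn} => [|n] e S0.
  by move: e; rewrite big_ord0 (absv0 hN) expr0 => /eqP; rewrite oner_eq0.
have : N z ^+ n.+1 <= (\sum_(i < n.+1) N f`_i) * N z ^+ n.
  rewrite e (le_trans (absv_sum hN _ _)) // mulr_suml; apply: ler_sum => i _.
  rewrite (absvM hN) (absvX hN); apply: ler_wpM2l; first exact: absv_ge0.
  by apply: ler_weXn2l; [exact: ltW|rewrite -ltnS].
rewrite exprS ler_pM2r ?exprn_gt0 //; lra.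
Qed.

Lemma horner_close (f g : {poly K}) n B w :
  (size f <= n.+1)%N -> (size g <= n.+1)%N -> 1 <= B -> N w <= B ->
  N (f.[w] - g.[w]) <= (\sum_(i < n.+1) N (f`_i - g`_i)) * B ^+ n.
Proof.
move=> sf sg B1 wB; have w0 := absv_ge0 hN w.
rewrite !(horner_coef_wide _ sf) (horner_coef_wide _ sg) -sumrB.
rewrite (le_trans (absv_sum hN _ _)) // mulr_suml; apply: ler_sum => i _.
rewrite -mulrBl (absvM hN) (absvX hN); apply: ler_wpM2l; first exact: absv_ge0.
apply: le_trans (_ : B ^+ i <= _).
  by apply: lerXn2r; rewrite ?nnegrE //; lra.
by apply: ler_weXn2l => //; rewrite -ltnS.
Qed.

(* A root of one monic polynomial is within eps of a root of any monic
   polynomial whose value there is below eps^n, because that value is the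
   product of the n distances. *)
Lemma cont_max_root (n : nat) (F : R -> {poly K}) (r : R -> seq K)
    (phi : K -> R) (mu : R -> R) :
  cont_poly N F -> (forall t, size (r t) = n) ->
  (forall t, F t = \prod_(z <- r t) ('X - z%:P)) ->
  (forall x y, `|phi x - phi y| <= N (x - y)) ->
  (forall t, exists2 z, z \in r t & phi z = mu t) ->
  (forall t z, z \in r t -> phi z <= mu t) ->
  cont Num.norm mu.
Proof.
move=> cF sr Fr lip attain maxi x eps e0.
have sF t : size (F t) = n.+1 by rewrite Fr size_prod_XsubC sr.
have Fn t : (F t)`_n = 1.
  have /monicP := monic_prod_XsubC (r t) xpredT id.
  by rewrite -Fr lead_coefE sF.
pose D t := \sum_(i < n.+1) N ((F t)`_i - (F x)`_i).
have cD : cont Num.norm D.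
  apply: (cont_sum (absolute_value_normr R)) => i; apply: cont_absv => //.
  by apply: (contD hN); [exact: cF|exact: cont_cst].
have Dx : D x = 0 by apply: big1 => i _; rewrite subrr (absv0 hN).
have D0 t : 0 <= D t by apply: sumr_ge0 => i _; apply: absv_ge0.
(* Where [D y <= 1], the coefficient sum exceeds the one at x by at most 1, so this B bounds the
   roots of [F y] uniformly. *)
set B := 2 + \sum_(i < n) N (F x)`_i.
have B1 : 1 <= B.
  by rewrite /B -[leLHS]addr0 lerD ?sumr_ge0 ?ler1n // => i _; apply: absv_ge0.
have Bn : 0 < B ^+ n by rewrite exprn_gt0 //; lra.
have m0 : 0 < Num.min 1 (eps ^+ n / B ^+ n).
  by rewrite lt_min ltr01 divr_gt0 // exprn_gt0.
have [d d0 Dd] := cD x _ m0.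
exists d => // t /Dd; rewrite Dx subr0 ger0_norm // lt_min => /andP[Dt1].
rewrite ltr_pdivlMr // => Dte {Dd}.
have rootB y z : D y <= 1 -> z \in r y -> N z <= B.
  move=> Dy zy.
  have Fz : (F y).[z] = 0 by apply/rootP; rewrite Fr root_prod_XsubC.
  rewrite (le_trans (monic_root_bound (sF y) (Fn y) Fz)) //.
  have : \sum_(i < n) N (F y)`_i <= \sum_(i < n) N (F x)`_i + D y.
    rewrite /D big_ord_recr /= addrA -big_split /=.
    rewrite -[leLHS]addr0 lerD ?(absv_ge0 hN) //; apply: ler_sum => i _.
    by rewrite -{1}[(F y)`_i](subrK (F x)`_i) addrC; apply: absvD.
  by rewrite /B; lra.
(* The root of [F y] attaining [mu y] has a root of [F y'] within eps, so the maximum drops by less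
   than eps. Used in both directions between x and t. *)
have step y y' : D y <= 1 ->
    (forall w, N w <= B -> N ((F y').[w] - (F y).[w]) < eps ^+ n) ->
    mu y - eps < mu y'.
  move=> Dy close; have [z zy <-] := attain y.
  have Fz : (F y).[z] = 0 by apply/rootP; rewrite Fr root_prod_XsubC.
  have := close z (rootB _ _ Dy zy); rewrite Fz subr0 Fr -(sr y').
  move=> /(near_root e0)[z' z'y' lt].
  have := maxi _ _ z'y'; have := lip z z'; rewrite ler_norml => /andP[]; lra.
have close w : N w <= B -> N ((F t).[w] - (F x).[w]) < eps ^+ n.
  by move=> wB; apply: le_lt_trans Dte; apply: horner_close; rewrite ?sF.
have h1 : mu x - eps < mu t by apply: step => //; rewrite Dx.
have h2 : mu t - eps < mu x.
  by apply: step; [exact: ltW|move=> w /close; rewrite absvB].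
rewrite ltr_norml; lra.
Qed.

End RootContinuity.

(* A largest root depends continuously on the parameter; dividing it out keeps
   the coefficients continuous, so the sorted roots are handled one by one. *)
Lemma count_pos_roots_const (R : realType) (n : nat) (F : R -> {poly R})
    (r : R -> seq R) :
  cont_poly Num.norm F -> (forall t, size (r t) = n) ->
  (forall t, F t = \prod_(z <- r t) ('X - z%:P)) ->
  (forall t, 0 \notin r t) ->
  count (> 0) (r 0) = count (> 0) (r 1).
Proof.
have hN := absolute_value_normr R.
elim: n F r => [|n IH] F r cF sr Fr r0.
  by have := sr 0; have := sr 1; case: (r 0) (r 1) => [|? ?] [|? ?].
wlog srt : r sr Fr r0 / forall t, sorted (fun a b => b <= a) (r t).
  move=> H; have p t := permEl (perm_sort (fun a b : R => b <= a) (r t)).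
  have := H (fun t => sort (fun a b => b <= a) (r t)).
  rewrite !(permP (p _)); apply=> t; rewrite ?size_sort ?mem_sort //.
  - by rewrite (perm_big _ (p t)) -Fr.
  - by apply: sort_sorted => a b; apply: le_total.
pose h t := head 0 (r t); pose s t := behead (r t).
have rE t : r t = h t :: s t by rewrite /h /s; case: (r t) (sr t).
have ss t : size (s t) = n by rewrite /s size_behead sr.
have ge_tr : transitive (fun a b : R => b <= a).
  by move=> a b c ab bc; apply: le_trans bc ab.
have ch : cont Num.norm h.
  apply: (cont_max_root hN (phi := id) cF sr Fr) => //.
  - by move=> t; exists (h t); rewrite // rE mem_head.
  - move=> t z; rewrite rE inE => /predU1P[->//|zs].
    by have := srt t; rewrite rE /= => /(order_path_min ge_tr)/allP/(_ _ zs).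
pose G t := \prod_(z <- s t) ('X - z%:P).
have FG t : F t = ('X - (h t)%:P) * G t by rewrite Fr rE big_cons.
have G_big t i : (n < i)%N -> (G t)`_i = 0.
  by move=> ni; rewrite nth_default // size_prod_XsubC ss.
have cG : cont_poly Num.norm G.
  (* The identity [F = ('X - h) * G] gives the coefficients of G from the top down, G_i = F_(i+1) +
     h G_(i+1), starting above degree n where they vanish. *)
  move=> i; have [k] := ubnP (n.+1 - i)%N; elim: k i => // k IHk i ik.
  have [ni|ni] := ltnP n i.
    by apply: eq_cont (cont_cst hN 0) => t; rewrite G_big.
  apply: eq_cont (contD hN (cF i.+1) (contM hN ch (IHk i.+1 _))).
    by move=> t; rewrite FG mulrBl coefB coefXM coefCM /= subrK.
  by rewrite subSS; move: ik; rewrite subSn.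
have s0 t : 0 \notin s t by have := r0 t; rewrite rE inE negb_or => /andP[].
rewrite !rE /= (IH _ s cG ss (fun=> erefl) s0).
have h0 t : h t != 0 by have := r0 t; rewrite rE inE negb_or eq_sym => /andP[].
by rewrite (cont_sign ch h0).
Qed.

(** * Restriction to lines *)

Section LinePolynomial.
Variables (R K : fieldType) (f : {rmorphism R -> K}) (m : nat).
Implicit Types (u v z : 'I_m -> K) (p : {mpoly R[m]}).

(** The polynomial w |-> p (u + w v) over a field K receiving the coefficients: K = R carries the
    eigenvalues, K = R[i] the half-plane argument. *)
Definition lineK u v p : {poly K} :=
  mmap (polyC \o f) (fun j => (u j)%:P + v j *: 'X) p.

Lemma horner_lineK u v p w :
  (lineK u v p).[w] = mmap f (fun j => u j + w * v j) p.
Proof.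
rewrite /lineK /mmap horner_sum; apply: eq_bigr => k _.
rewrite hornerM /= hornerC /mmap1 horner_prod; congr (_ * _).
by apply: eq_bigr => j _; rewrite horner_exp !hornerE mulrC.
Qed.

Lemma mmap_homog n p c z : p \is n.-homog ->
  mmap f (fun j => c * z j) p = c ^+ n * mmap f z p.
Proof.
move=> /dhomogP hp; rewrite /mmap mulr_sumr.
rewrite big_seq [RHS]big_seq; apply: eq_bigr => k /hp /= <-.
rewrite mulrCA; congr (_ * _); rewrite /mmap1 mdegE -prodrXr -big_split /=.
by apply: eq_bigr => j _; rewrite exprMn.
Qed.

(** Degree at most d with coefficient c in degree d. Allowing c = 0, unlike [lead_coef], makes it
    stable under sums and products. *)
Let top d (A : {poly K}) c := (size A <= d.+1)%N /\ A`_d = c.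

Let topM d d' A A' c c' : top d A c -> top d' A' c' -> top (d + d') (A * A') (c * c').
Proof.
move=> [sA Ac] [sA' Ac']; split.
  by apply: leq_trans (size_polyMleq _ _) _; lia.
rewrite coefM; have lt : (d < (d + d').+1)%N by rewrite ltnS leq_addr.
rewrite (bigD1 (Ordinal lt)) //= addKn Ac Ac' big1 ?addr0 // => i.
rewrite -val_eqE /= => ne; have [id|di] := ltnP i d.
  rewrite [A'`_ _]nth_default ?mulr0 // (leq_trans sA') //; lia.
by rewrite [A`_i]nth_default ?mul0r // (leq_trans sA) // ltn_neqAle eq_sym ne.
Qed.

Lemma lineK_top n u v p : p \is n.-homog ->
  (size (lineK u v p) <= n.+1)%N /\ (lineK u v p)`_n = mmap f v p.
Proof.
move=> /dhomogP hp; rewrite /lineK /mmap.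
rewrite big_seq [in RHS]big_seq.
apply: (big_ind2 (fun A c => top n A c)).
- by split; rewrite ?size_poly0 ?coef0.
- move=> A c A' c' [sA <-] [sA' <-]; split; last by rewrite coefD.
  by apply: leq_trans (size_polyD _ _) _; rewrite geq_max sA.
- move=> k /hp /= <-; rewrite -[mdeg k]add0n; apply: topM.
    by split; rewrite ?size_polyC_leq1 ?coefC.
  rewrite mdegE /mmap1; elim: (index_enum _) => [|j s IH].
    by rewrite !big_nil; split; rewrite ?size_polyC ?coefC ?oner_eq0.
  rewrite !big_cons; apply: topM => {s IH}//; elim: (k j) => [|d IH].
    by rewrite !expr0; split; rewrite ?size_polyC ?coefC ?oner_eq0.
  rewrite !exprS -add1n; apply: topM => //; split.
    apply: leq_trans (size_polyD _ _) _; rewrite geq_max.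
    rewrite (leq_trans (size_polyC_leq1 _)) //.
    by rewrite (leq_trans (size_scale_leq _ _)) ?size_polyX.
  by rewrite coefD coefC coefZ coefX add0r mulr1.
Qed.

End LinePolynomial.

Lemma cont_lineK (R : realType) (K : fieldType) (N : K -> R)
    (hN : absolute_value N) (f : {rmorphism R -> K}) (m : nat)
    (u v : R -> 'I_m -> K) (p : {mpoly R[m]}) :
  (forall j, cont N (fun t => u t j)) -> (forall j, cont N (fun t => v t j)) ->
  cont_poly N (fun t => lineK f (u t) (v t) p).
Proof.
move=> cu cv; apply: (cont_poly_sum hN) => k; apply: (cont_polyM hN).
  exact: cont_poly_cst.
apply: (cont_poly_prod hN) => j; apply: (cont_polyX hN).
apply: (cont_polyD hN); first exact: cont_polyC.
apply: eq_cont_poly (_ : cont_poly N (fun t => (v t j)%:P * 'X)).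
  by move=> t; rewrite mul_polyC.
by apply: (cont_polyM hN); [exact: cont_polyC|exact: cont_poly_cst].
Qed.

Lemma mmap_comp (R K L : fieldType) (f : {rmorphism R -> K})
    (g : {rmorphism K -> L}) (m : nat) (z : 'I_m -> K) (p : {mpoly R[m]}) :
  g (mmap f z p) = mmap (g \o f) (g \o z) p.
Proof.
rewrite /mmap rmorph_sum; apply: eq_bigr => k _ /=.
rewrite rmorphM /mmap1 rmorph_prod; congr (_ * _).
by apply: eq_bigr => j _; rewrite rmorphXn.
Qed.

Lemma mmap_real_complex (R : realType) (m : nat) (v : 'I_m -> R)
    (p : {mpoly R[m]}) :
  mmap (real_complex R) (fun j => real_complex R (v j)) p
  = real_complex R p.@[v].
Proof. by rewrite /meval mmap_comp. Qed.

Lemma eq_mmap (R K : fieldType) (f : {rmorphism R -> K}) (m : nat)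
    (z z' : 'I_m -> K) (p : {mpoly R[m]}) :
  z =1 z' -> mmap f z p = mmap f z' p.
Proof. by move=> /funext ->. Qed.

Lemma map_lineK (R : realType) (m : nat) (u v : 'I_m -> R) (p : {mpoly R[m]}) :
  map_poly (real_complex R) (lineK idfun u v p)
  = lineK (real_complex R) (fun j => real_complex R (u j))
      (fun j => real_complex R (v j)) p.
Proof.
rewrite /lineK /mmap rmorph_sum; apply: eq_bigr => k _ /=.
rewrite rmorphM /mmap1 rmorph_prod /= map_polyC; congr (_ * _).
apply: eq_bigr => j _; rewrite rmorphXn; congr (_ ^+ _).
by rewrite /= rmorphD /= map_polyC map_polyZ map_polyX.
Qed.

(** * Eigenvalues *)

Lemma poly_ext (R : numDomainType) (f g : {poly R}) :
  (forall t, f.[t] = g.[t]) -> f = g.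
Proof.
move=> fg; apply/eqP; rewrite -subr_eq0; apply/negP => /negP h0.
set h := f - g in h0.
have u : uniq [seq i%:R : R | i <- iota 0 (size h)].
  by rewrite map_inj_uniq ?iota_uniq //; apply: mulrIn; rewrite oner_eq0.
have al : all (root h) [seq i%:R : R | i <- iota 0 (size h)].
  by apply/allP => z _; apply/rootP; rewrite !hornerE fg subrr.
by have := max_poly_roots h0 al u; rewrite size_map size_iota ltnn.
Qed.

(** Split f over the algebraically closed field R[i]; the roots equal their real parts, so the
    factorization descends to R. *)
Lemma root_real_split (R : realType) (f : {poly R}) :
  (forall z, root (map_poly (real_complex R) f) z -> complex.Im z = 0) ->
  exists s : seq R, f = lead_coef f *: \prod_(z <- s) ('X - z%:P).
Proof.
move=> fR; have [r fr] := closed_field_poly_normal (map_poly (real_complex R) f).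
have [->|f0] := eqVneq f 0; first by exists [::]; rewrite lead_coef0 scale0r.
exists (map (@complex.Re R) r); apply: (map_poly_inj (real_complex R)).
rewrite {1}fr lead_coef_map map_polyZ; congr (_ *: _).
rewrite big_map rmorph_prod /= big_seq [RHS]big_seq; apply: eq_bigr => z zr.
rewrite rmorphB /= map_polyX map_polyC; congr (_ - _%:P).
have : root (map_poly (real_complex R) f) z.
  by rewrite fr rootZ ?root_prod_XsubC // lead_coef_map fmorph_eq0 lead_coef_eq0.
by move=> /fR; case: (z) => a b /= ->.
Qed.

Definition pval (R : realType) (m : nat) (p : {mpoly R[m]}) (v : 'rV[R]_m) : R :=
  p.@[v ord0].

(* [eigs n p e x s]: s lists the n roots of lambda |-> p (x - lambda e), with
   multiplicity and in any order. *)
Definition eigs (R : realType) (m n : nat) (p : {mpoly R[m]})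
    (e x : 'rV[R]_m) (s : seq R) : Prop :=
  size s = n /\
  forall t, pval p (x + t *: e) = pval p e * \prod_(l <- s) (t + l).

(** The working form of hyperbolicity. Homogeneity and p (e) > 0 are included, so that a single
    statement passes to other directions, to derivatives and to pencils. *)
Record hyp (R : realType) (m n : nat) (p : {mpoly R[m]}) (e : 'rV[R]_m) : Prop :=
  Hyp {
    hyp_homog : p \is n.-homog;
    hyp_gt0 : 0 < pval p e;
    hyp_eigs : forall x, exists s, eigs n p e x s }.

Definition epos (R : realType) (m n : nat) (p : {mpoly R[m]})
    (e x : 'rV[R]_m) : Prop :=
  exists2 s, eigs n p e x s & all (> 0) s.

Definition enneg (R : realType) (m n : nat) (p : {mpoly R[m]})
    (e x : 'rV[R]_m) : Prop :=
  exists2 s, eigs n p e x s & all (>= 0) s.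

Definition lineR (R : realType) (m : nat) (p : {mpoly R[m]})
    (x e : 'rV[R]_m) : {poly R} :=
  lineK idfun (x ord0) (e ord0) p.

Lemma prodr_scale (R : comNzRingType) (T : Type) (s : seq T) (c : R) (F : T -> R) :
  c ^+ size s * \prod_(l <- s) F l = \prod_(l <- s) (c * F l).
Proof.
elim: s => [|l s IH]; first by rewrite !big_nil mulr1.
by rewrite /= !big_cons -IH exprS; ring.
Qed.

Section Eigenvalues.
Variables (R : realType) (m n : nat) (p : {mpoly R[m]}).
Implicit Types (e x a b v : 'rV[R]_m) (s : seq R).
Local Notation C := (real_complex R).

Lemma pvalZ c v : p \is n.-homog -> pval p (c *: v) = c ^+ n * pval p v.
Proof.
move=> hp; rewrite /pval /meval -(mmap_homog idfun _ _ hp).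
by apply: eq_mmap => j; rewrite mxE.
Qed.

Lemma horner_lineR x e t : (lineR p x e).[t] = pval p (x + t *: e).
Proof.
by rewrite horner_lineK; apply: eq_mmap => j; rewrite !mxE.
Qed.

Lemma lineR_top x e : p \is n.-homog ->
  (size (lineR p x e) <= n.+1)%N /\ (lineR p x e)`_n = pval p e.
Proof. exact: lineK_top. Qed.

Lemma prod_addE (s : seq R) :
  \prod_(z <- map -%R s) ('X - z%:P) = \prod_(l <- s) ('X + l%:P).
Proof. by rewrite big_map; apply: eq_bigr => l _; rewrite polyCN opprK. Qed.

Lemma eigs_lineR e x s : eigs n p e x s ->
  lineR p x e = pval p e *: \prod_(l <- s) ('X + l%:P).
Proof.
move=> [_ h]; apply: poly_ext => t; rewrite horner_lineR h hornerZ.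
by rewrite horner_prod; congr (_ * _); apply: eq_bigr => l _; rewrite !hornerE.
Qed.

Lemma eigs_perm e x s s' : pval p e != 0 ->
  eigs n p e x s -> eigs n p e x s' -> perm_eq s s'.
Proof.
move=> pe h h'; have := eigs_lineR h; rewrite (eigs_lineR h').
move=> /(scalerI pe); rewrite -!prod_addE => /prod_XsubC_eq pm.
have NN (l : seq R) : map -%R (map -%R l) = l.
  by rewrite -map_comp map_id_in // => z _ /=; rewrite opprK.
by rewrite perm_sym -(NN s) -(NN s'); apply: perm_map.
Qed.

Lemma eigs_perm_eq e x s s' : perm_eq s s' -> eigs n p e x s -> eigs n p e x s'.
Proof.
move=> ss' [h1 h2]; split; first by rewrite -(perm_size ss').
by move=> t; rewrite h2 (perm_big _ ss').
Qed.

Lemma eigs_shift e x s c :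
  eigs n p e x s -> eigs n p e (x + c *: e) [seq l + c | l <- s].
Proof.
move=> [h1 h2]; split; first by rewrite size_map.
move=> t; rewrite -addrA -scalerDl h2 big_map; congr (_ * _).
by apply: eq_bigr => l _; ring.
Qed.

Lemma eigs_scale e x s c : p \is n.-homog -> 0 < c ->
  eigs n p e x s -> eigs n p e (c *: x) [seq c * l | l <- s].
Proof.
move=> hp c0 [h1 h2]; split; first by rewrite size_map.
move=> t; have -> : c *: x + t *: e = c *: (x + (t / c) *: e).
  by rewrite scalerDr scalerA mulrCA divff ?gt_eqF // mulr1.
rewrite pvalZ // h2 mulrCA big_map; congr (_ * _).
rewrite -h1 prodr_scale; apply: eq_bigr => l _.
by rewrite mulrDr mulrCA divff ?gt_eqF // mulr1.
Qed.

Lemma eigs0 e : p \is n.-homog -> eigs n p e 0 (nseq n 0).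
Proof.
move=> hp; split; first by rewrite size_nseq.
by move=> t; rewrite add0r pvalZ // big_nseq addr0 iter_mulr_1 mulrC.
Qed.

Lemma eigs_pval e x s : eigs n p e x s -> pval p x = pval p e * \prod_(l <- s) l.
Proof.
move=> [_ /(_ 0)]; rewrite scale0r addr0 => ->; congr (_ * _).
by apply: eq_bigr => l _; rewrite add0r.
Qed.

Lemma epos_gt0 e x : hyp n p e -> epos n p e x -> 0 < pval p x.
Proof.
move=> he [s hs /allP spos]; rewrite (eigs_pval hs) mulr_gt0 ?(hyp_gt0 he) //.
by rewrite big_seq; apply: prodr_gt0.
Qed.

Definition cvec (v : 'rV[R]_m) (j : 'I_m) : R[i] := C (v ord0 j).

Lemma eigs_complex e x s (w : R[i]) : eigs n p e x s ->
  mmap C (fun j => cvec x j + w * cvec e j) p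
  = C (pval p e) * \prod_(l <- s) (w + C l).
Proof.
move=> /eigs_lineR h.
have -> : mmap C (fun j => cvec x j + w * cvec e j) p
    = (map_poly C (lineR p x e)).[w] by rewrite map_lineK horner_lineK.
rewrite h map_polyZ hornerZ rmorph_prod horner_prod; congr (_ * _).
by apply: eq_bigr => l _; rewrite rmorphD /= map_polyX map_polyC !hornerE.
Qed.

End Eigenvalues.

Lemma seq_argmax (R : realType) (T : eqType) (phi : T -> R) (s : seq T) :
  s != [::] -> exists2 z, z \in s & forall y, y \in s -> phi y <= phi z.
Proof.
elim: s => [//|x s IH] _; case: (eqVneq s [::]) => [->|/IH[z zs hz]].
  by exists x; rewrite ?mem_head // => y; rewrite inE => /eqP->.
have [le|lt] := leP (phi x) (phi z).
  by exists z; rewrite ?inE ?zs ?orbT // => y; rewrite inE => /predU1P[->//|/hz].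
exists x; rewrite ?mem_head // => y; rewrite inE => /predU1P[->//|/hz h].
by apply: le_trans h (ltW lt).
Qed.

Lemma seq_gt_margin (R : realType) (s : seq R) :
  all (> 0) s -> exists2 d, 0 < d & all (> d) s.
Proof.
elim: s => [|x s IH] /=; first by exists 1.
move=> /andP[x0 /IH[d d0 /allP ds]]; exists (Num.min d (x / 2)).
  by rewrite lt_min d0 divr_gt0.
apply/andP; split; first by rewrite gt_min; apply/orP; right; lra.
by apply/allP => y /ds /=; rewrite gt_min => ->.
Qed.

(** * Hyperbolicity in all positive directions *)

Section Garding.
Variables (R : realType) (m n : nat) (p : {mpoly R[m]}) (e : 'rV[R]_m).
Hypothesis he : hyp n p e.
Implicit Types (x a : 'rV[R]_m).
Local Notation C := (real_complex R).
Local Notation Im := complex.Im.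
Local Notation cvec := (@cvec R m).

Lemma mmap0_cvec (z : 'I_m -> R[i]) : n = 0%N ->
  mmap C z p = C (pval p e).
Proof.
move=> n0; have hp := hyp_homog he; rewrite n0 in hp.
have h z' : mmap C (fun j => 0 * z' j) p = mmap C z' p.
  by rewrite (mmap_homog _ _ _ hp) expr0 mul1r.
rewrite -(mmap_real_complex _ p) -h -[RHS]h.
by apply: eq_mmap => j; rewrite !mul0r.
Qed.

(* A root w with [Im w >= 0] would have to cross the real axis on the way from
   x = 0, where all roots are below it; but p is e-hyperbolic, so there is no
   real root at any time. *)
Lemma upper_half_nonzero x a (u : R) (w : R[i]) :
  epos n p e a -> 0 < u -> 0 <= Im w ->
  mmap C (fun j => (cvec x j + C u * 'i%C * cvec e j) + w * cvec a j) p != 0.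
Proof.
move=> pa u0 w0; have pe := hyp_gt0 he; have hN := absolute_value_normc R.
have CI (c : R) : (C c == 0) = (c == 0) by rewrite fmorph_eq0.
(* A largest imaginary part exists only if there is a root, so degree 0 is settled first. *)
have [n0|n0] := posnP n; first by rewrite mmap0_cvec // CI gt_eqF.
have pa0 := epos_gt0 he pa; case: pa => sa hsa /allP sapos.
pose U t j := C t * cvec x j + C u * 'i%C * cvec e j.
pose F t := (C (pval p a))^-1 *: lineK C (U t) (cvec a) p.
have a0 : (C (pval p a))^-1 != 0 by rewrite invr_eq0 CI gt_eqF.
have cF : cont_poly (@Normc.normc R) F.
  apply: eq_cont_poly
    (_ : cont_poly _ (fun t => (C (pval p a))^-1%:P * lineK C (U t) (cvec a) p)).
    by move=> t; rewrite mul_polyC.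
  apply: (cont_polyM hN); first exact: cont_poly_cst.
  apply: (cont_lineK hN) => j; last exact: cont_cst.
  apply: (contD hN); last exact: cont_cst.
  apply: (contM hN); last exact: cont_cst.
  by apply: cont_real_complex => y eps e0; exists eps.
have top t : size (F t) = n.+1 /\ F t \is monic.
  have [sl] := lineK_top C (U t) (cvec a) (hyp_homog he).
  rewrite mmap_real_complex -/(pval p a) => lt.
  have Fn : (F t)`_n = 1 by rewrite coefZ lt mulVf // CI gt_eqF.
  have sF : size (F t) = n.+1.
    apply/eqP; rewrite eqn_leq; apply/andP; split.
      by rewrite size_scale.
    rewrite ltnNge; apply/negP => sz; move: Fn; rewrite nth_default // => /eqP.
    by rewrite eq_sym oner_eq0.
  by split=> //; apply/monicP; rewrite lead_coefE sF.
have /choice[r Fr] : forall t, exists r : seq R[i], F t = \prod_(z <- r) ('X - z%:P).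
  move=> t; have [r ->] := closed_field_poly_normal (F t).
  by exists r; have /monicP -> := (top t).2; rewrite scale1r.
have sr t : size (r t) = n.
  by have := (top t).1; rewrite Fr size_prod_XsubC => -[].
have rootF t z : (z \in r t) = (mmap C (fun j => U t j + z * cvec a j) p == 0).
  rewrite -root_prod_XsubC -Fr rootE hornerZ mulf_eq0 (negPf a0) /=.
  by rewrite horner_lineK.
have /choice[zm zmP] :
    forall t, exists z, z \in r t /\ forall y, y \in r t -> Im y <= Im z.
  move=> t; have [|z ? ?] := @seq_argmax R _ (@Im R) (r t); last by exists z.
  by rewrite -size_eq0 sr -lt0n.
have lip (y z : R[i]) : `|Im y - Im z| <= Normc.normc (y - z).
  case: y z => [a1 b1] [a2 b2] /=.
  by rewrite -sqrtr_sqr ler_wsqrtr // lerDr sqr_ge0.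
have cmu : cont Num.norm (fun t => Im (zm t)).
  apply: (cont_max_root hN (phi := @Im R) cF sr Fr lip).
    by move=> t; exists (zm t) => //; case: (zmP t).
  by move=> t z; case: (zmP t) => _; apply.
(* A real root c would make - i u an eigenvalue of the real vector t x + c a, whose eigenvalues are
   all real. *)
have mu0 t : Im (zm t) != 0.
  apply/negP => /eqP im0; have [+ _] := zmP t; rewrite rootF.
  have zE : zm t = C (complex.Re (zm t)) by move: im0; case: (zm t) => c d /= ->.
  have [s hs] := hyp_eigs he (t *: x + complex.Re (zm t) *: a).
  have := eigs_complex (C u * 'i%C) hs.
  move=> E; apply/negP.
  rewrite (_ : mmap _ _ _ = C (pval p e) * \prod_(l <- s) (C u * 'i%C + C l));
    last first.
    rewrite -E; apply: eq_mmap => j; rewrite /U /cvec !mxE !rmorphD !rmorphM /=.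
    by rewrite -zE; ring.
  rewrite mulf_eq0 CI (gt_eqF pe) /= prodf_seq_eq0; apply/hasPn => l _ /=.
  apply/eqP => /(congr1 (@Im R)); simpc => /=.
  by move/eqP; rewrite gt_eqF //; lra.
(* At t = 0, homogeneity gives p (i u e + z a) = z^n p (a + (i u / z) e) for z <> 0. Hence i u / z =
   - l with l a positive eigenvalue of a, that is z = - i u / l. *)
have neg0 : Im (zm 0) < 0.
  have [+ _] := zmP 0; set z := zm 0; rewrite rootF /U.
  have UE j : C 0 * cvec x j + C u * 'i%C * cvec e j = C u * 'i%C * cvec e j.
    by rewrite rmorph0 mul0r add0r.
  rewrite (eq_mmap _ _ (fun j => congr1 (+%R^~ _) (UE j))).
  have [->|z0] := eqVneq z 0.
    rewrite (eq_mmap _ (z' := fun j => C u * 'i%C * cvec e j)); last first.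
      by move=> j; rewrite mul0r addr0.
    rewrite (mmap_homog _ _ _ (hyp_homog he)) mmap_real_complex -/(pval p e).
    rewrite mulf_eq0 CI (gt_eqF pe) orbF expf_eq0 mulf_eq0 CI (gt_eqF u0) /=.
    by rewrite eq_complex /= oner_eq0 !andbF.
  rewrite (eq_mmap _
    (z' := fun j => z * (cvec a j + (C u * 'i%C / z) * cvec e j))); last first.
    by move=> j; field.
  rewrite (mmap_homog _ _ _ (hyp_homog he)) (eigs_complex _ hsa).
  rewrite !mulf_eq0 CI (gt_eqF pe) expf_eq0 (negPf z0) andbF /=.
  rewrite prodf_seq_eq0 => /hasP[l ls /= /eqP hl].
  have l0 := sapos _ ls.
  have : C u * 'i%C + C l * z = 0.
    have -> : C u * 'i%C + C l * z = z * (C u * 'i%C / z + C l) by field.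
    by rewrite hl mulr0.
  move=> /(congr1 (@Im R)); case: (z) => c d; simpc => /= E.
  rewrite ltNge; apply/negP => d0; have : 0 <= l * d by rewrite mulr_ge0 // ltW.
  lra.
have neg1 : Im (zm 1) < 0.
  have := cont_sign cmu mu0; rewrite [in LHS]ltNge ltW //= => /esym/negbT.
  by rewrite -leNgt lt_neqAle mu0.
apply/negP => Pw.
have : w \in r 1.
  rewrite rootF -(eqP Pw); apply/eqP; apply: eq_mmap => j.
  by rewrite /U rmorph1 mul1r.
move=> /(zmP 1).2; lra.
Qed.

Lemma epos_margin a : epos n p e a ->
  exists2 d, 0 < d & epos n p e (a - d *: e).
Proof.
move=> [s hs /seq_gt_margin[d d0 ds]]; exists d => //.
exists [seq l + - d | l <- s]; first by rewrite -scaleNr; apply: eigs_shift.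
by rewrite all_map; apply: sub_all ds => l /=; rewrite subr_gt0.
Qed.

Lemma hyp_epos a : epos n p e a -> hyp n p a.
Proof.
move=> pa; have pa0 := epos_gt0 he pa; split=> //; first exact: hyp_homog he.
(* Split i t a as i t d e + i t (a - d e): since a - d e is still positive, [upper_half_nonzero]
   applies with u = t d and w = i t, and only the direction a remains. *)
move=> x; have [d d0 pa'] := epos_margin pa.
have nz y t : 0 < t ->
    mmap C (fun j => cvec y j + C t * 'i%C * cvec a j) p != 0.
  move=> t0; have := upper_half_nonzero y pa' (mulr_gt0 t0 d0).
  move=> /(_ (C t * 'i%C)).
  rewrite (eq_mmap _
    (z' := fun j => cvec y j + C t * 'i%C * cvec a j)); last first.
    move=> j; rewrite /cvec !mxE !rmorphD !rmorphN !rmorphM /=; ring.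
  by apply; simpc; rewrite /= ltW.
have rootE z : root (map_poly C (lineR p x a)) z ->
    mmap C (fun j => cvec x j + z * cvec a j) p = 0.
  by move=> /rootP; rewrite map_lineK horner_lineK.
have nz' z : root (map_poly C (lineR p x a)) z -> Im z <= 0.
  move=> /rootE E; rewrite leNgt; apply/negP => z0.
  have /eqP := nz (x + complex.Re z *: a) _ z0; apply; rewrite -[RHS]E.
  apply: eq_mmap => j; rewrite [in RHS](complexE z) /cvec !mxE !rmorphD !rmorphM /=.
  ring.
(* Real coefficients make the roots stable under conjugation, so Im z <= 0 at every root forces Im z
   = 0. *)
have [z rz|s hs] := @root_real_split R (lineR p x a).
  apply/eqP; rewrite eq_le nz' //=.
  have : root (map_poly C (lineR p x a)) z^*%C.
    rewrite -complex_root_conj -map_poly_comp /=.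
    rewrite (eq_map_poly (g := C)) // => c; exact: conjc_real.
  by move=> /nz'; case: (z) => c d' /=; rewrite oppr_le0.
have [sl ln] := lineR_top x a (hyp_homog he).
have sz : size (lineR p x a) = n.+1.
  apply/eqP; rewrite eqn_leq sl ltnNge; apply/negP => le.
  by move: ln; rewrite nth_default // => /eqP; rewrite lt_eqF.
have lc : lead_coef (lineR p x a) = pval p a by rewrite lead_coefE sz.
exists (map -%R s); split.
  rewrite size_map; move: sz; rewrite hs size_scale ?size_prod_XsubC => [[]//|].
  by rewrite lc gt_eqF.
by move=> t; rewrite -horner_lineR hs hornerZ lc horner_prod_XsubC big_map.
Qed.

End Garding.

(** * Inertia and monotonicity of eigenvalues *)

(** Extends the segment from e to a to a path over all of R: the continuity lemmas concern functions
    on the whole line, but points beyond the segment may leave the positive cone. *)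
Definition clamp (R : realType) (t : R) : R :=
  if t < 0 then 0 else if 1 < t then 1 else t.

Lemma clamp_bounds (R : realType) (t : R) : 0 <= clamp t <= 1.
Proof. by rewrite /clamp; case: ltP => h1; [lra|case: ltP => h2; lra]. Qed.

Lemma clamp0 (R : realType) : clamp 0 = 0 :> R.
Proof. by rewrite /clamp ltxx ltNge ler01. Qed.

Lemma clamp1 (R : realType) : clamp 1 = 1 :> R.
Proof. by rewrite /clamp ltxx ltNge ler01. Qed.

Lemma cont_clamp (R : realType) : cont Num.norm (@clamp R).
Proof.
move=> x eps e0; exists eps => // y; rewrite !ltr_norml /clamp.
by case: (ltP y 0) => h1; case: (ltP x 0) => h2; case: (ltP 1 y) => h3;
  case: (ltP 1 x) => h4; lra.
Qed.

(** Supplies a threshold T that is not an eigenvalue, so that p (x - T e) <> 0 and [inertia]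
    applies. *)
Lemma avoid_seq (R : realType) (r : seq R) (l u : R) :
  l < u -> exists T, [/\ l < T, T < u & T \notin r].
Proof.
elim: r u => [|y r IH] u lu; first by exists ((l + u) / 2); split=> //; lra.
have [ly|yl] := ltP l y.
  have [|T [lT]] := IH (Num.min u y); first by rewrite lt_min lu.
  rewrite lt_min => /andP[Tu Ty] Tr; exists T; split=> //.
  by rewrite inE negb_or lt_eqF.
have [T [lT Tu Tr]] := IH u lu; exists T; split=> //.
by rewrite inE negb_or Tr andbT gt_eqF // (le_lt_trans yl).
Qed.

Local Notation desc := (sorted (fun a b => b <= a)).

Lemma desc_nth (R : realType) (s : seq R) i j : desc s ->
  (i <= j)%N -> (j < size s)%N -> nth 0 s j <= nth 0 s i.
Proof.
move=> ds ij js.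
have tr : transitive (fun a b : R => b <= a) by move=> a b c /[swap]; apply: le_trans.
by apply: (sorted_leq_nth tr _ 0 ds) => //; rewrite inE // (leq_ltn_trans ij).
Qed.

Lemma desc_sort (R : realType) (s : seq R) : desc (sort (fun a b => b <= a) s).
Proof. by apply: sort_sorted => a b; apply: le_total. Qed.

(** Turns comparisons of ordered eigenvalues into comparisons of the numbers of positive ones, which
    [inertia] controls. *)
Lemma desc_count (R : realType) (s : seq R) k : desc s -> (k < size s)%N ->
  (0 < nth 0 s k) = (k < count (> 0)%R s)%N.
Proof.
move=> ds ks; rewrite -{2}(cat_take_drop k s) count_cat.
have sz : size (take k s) = k by rewrite size_takel // ltnW.
have [pk|nk] := ltP 0 (nth 0 s k).
  have -> : count (> 0)%R (take k s) = k.
    rewrite -[RHS]sz; apply/eqP; rewrite -all_count; apply/(all_nthP 0) => i.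
    rewrite sz => ik; rewrite nth_take //; apply: lt_le_trans pk _.
    exact: desc_nth (ltnW ik) ks.
  by rewrite (drop_nth 0 ks) /= pk addnS ltnS leq_addr.
have -> : count (> 0)%R (drop k s) = 0%N.
  apply/eqP; rewrite -leqn0 leqNgt -has_count; apply/(has_nthP 0); case=> i.
  rewrite size_drop nth_drop => ik; apply/negP; rewrite -leNgt.
  by apply: le_trans nk; apply: desc_nth; rewrite ?leq_addr // -ltn_subRL.
by rewrite addn0 ltnNge -{2}sz count_size.
Qed.

Section Cone.
Variables (R : realType) (m n : nat) (p : {mpoly R[m]}) (e : 'rV[R]_m).
Hypothesis he : hyp n p e.
Implicit Types (x a b : 'rV[R]_m) (s : seq R).

Lemma epos_dir : epos n p e e.
Proof.
have := eigs_shift 1 (eigs0 e (hyp_homog he)).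
rewrite add0r scale1r => h; exists [seq l + 1 | l <- nseq n 0] => //.
by rewrite all_map; apply/allP => l /nseqP[-> _] /=; rewrite add0r.
Qed.

Lemma epos_segment a c : epos n p e a -> 0 <= c <= 1 ->
  epos n p e (e + c *: (a - e)).
Proof.
move=> [s hs /allP spos] /andP[c0 c1].
have [->|c_neq0] := eqVneq c 0; first by rewrite scale0r addr0; apply: epos_dir.
have c_gt0 : 0 < c by rewrite lt_neqAle eq_sym c_neq0.
have -> : e + c *: (a - e) = c *: a + (1 - c) *: e.
  by rewrite scalerBr scalerBl scale1r addrCA addrA.
have := eigs_shift (1 - c) (eigs_scale (hyp_homog he) c_gt0 hs).
move=> h; exists [seq l + (1 - c) | l <- [seq c * l | l <- s]] => //.
apply/allP => _ /mapP[_ /mapP[l /spos l0 ->] ->] /=.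
by rewrite ltr_pwDl ?subr_ge0 // mulr_gt0.
Qed.

(* The zeros of r |-> p (d - r x) are the inverses of the d-eigenvalues of x,
   and its leading coefficient does not depend on the direction d. *)
Lemma eigs_reverse d x s : p \is n.-homog -> 0 < pval p d -> pval p x != 0 ->
  eigs n p d x s ->
  (pval p (- x))^-1 *: lineR p d (- x)
  = \prod_(z <- [seq l^-1 | l <- s]) ('X - z%:P).
Proof.
move=> hp pd px hs; have [sn h] := hs.
have s0 l : l \in s -> l != 0.
  move=> ls; apply: contraNneq px => l0; rewrite (eigs_pval hs) mulf_eq0.
  by apply/orP; right; rewrite prodf_seq_eq0; apply/hasP; exists l => //=; rewrite l0.
have pN : pval p (- x) = pval p d * \prod_(l <- s) - l.
  rewrite -scaleN1r (pvalZ _ _ hp) (eigs_pval hs) mulrCA -sn prodr_scale.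
  by congr (_ * _); apply: eq_bigr => l _; rewrite mulN1r.
have pN0 : pval p (- x) != 0.
  by rewrite -scaleN1r (pvalZ _ _ hp) mulf_neq0 // expf_neq0 // oppr_eq0 oner_eq0.
apply: poly_ext => r; rewrite hornerZ horner_lineR horner_prod_XsubC.
apply: (mulfI pN0); rewrite mulrA divff // mul1r pN -mulrA big_map -big_split /=.
have -> : pval p (d + r *: - x) = pval p d * \prod_(l <- s) (1 - r * l).
  have [->|r0] := eqVneq r 0.
    rewrite scale0r addr0 big1 ?mulr1 // => l _; ring.
  have -> : d + r *: - x = - r *: (x + - r^-1 *: d).
    by rewrite scalerDr scalerA mulrNN divff // scale1r scalerN scaleNr addrC.
  rewrite (pvalZ _ _ hp) h mulrCA -sn prodr_scale; congr (_ * _).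
  by apply: eq_bigr => l _; field.
congr (_ * _); rewrite big_seq [RHS]big_seq; apply: eq_bigr => l /s0 l0.
by field.
Qed.

(** While the direction runs from e to a, the inverse eigenvalues of x are the roots of a monic
    family with continuous coefficients. They never vanish and have the signs of the eigenvalues, so
    [count_pos_roots_const] applies. *)
Lemma inertia a x s s' : epos n p e a -> pval p x != 0 ->
  eigs n p e x s -> eigs n p a x s' -> count (> 0) s = count (> 0) s'.
Proof.
move=> pa px hs hs'; have hN := absolute_value_normr R.
have hp := hyp_homog he.
pose d t := e + clamp t *: (a - e).
have hd t : hyp n p (d t) by apply: (hyp_epos he); apply: epos_segment (clamp_bounds t).
have /choice[sg hsg] t : exists sg, eigs n p (d t) x sg := hyp_eigs (hd t) x.
pose F t := (pval p (- x))^-1 *: lineR p (d t) (- x).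
have cF : cont_poly Num.norm F.
  apply: eq_cont_poly
    (_ : cont_poly _ (fun t => (pval p (- x))^-1%:P * lineR p (d t) (- x))).
    by move=> t; rewrite mul_polyC.
  apply: (cont_polyM hN); first exact: cont_poly_cst.
  apply: (cont_lineK hN) => j; last exact: cont_cst.
  apply: eq_cont (_ : cont _ (fun t => e ord0 j + clamp t * (a - e) ord0 j)).
    by move=> t; rewrite !mxE.
  apply: (contD hN); first exact: cont_cst.
  by apply: (contM hN); [exact: cont_clamp|exact: cont_cst].
have FE t : F t = \prod_(z <- [seq l^-1 | l <- sg t]) ('X - z%:P).
  by apply: eigs_reverse => //; apply: hyp_gt0 (hd t).
have szs t : size [seq l^-1 | l <- sg t] = n by rewrite size_map; case: (hsg t).
have nz t : 0 \notin [seq l^-1 | l <- sg t].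
  apply/mapP => -[l ls /esym/eqP]; rewrite invr_eq0 => /eqP l0.
  move: px; rewrite (eigs_pval (hsg t)) mulf_eq0 prodf_seq_eq0 => /norP[_].
  by move=> /hasPn/(_ _ ls); rewrite /= l0 eqxx.
have := count_pos_roots_const cF szs FE nz.
rewrite !count_map !(eq_count (a2 := (> 0))); last 2 first.
- by move=> l /=; rewrite invr_gt0.
- by move=> l /=; rewrite invr_gt0.
have d0 : d 0 = e by rewrite /d clamp0 scale0r addr0.
have d1 : d 1 = a by rewrite /d clamp1 scale1r addrC subrK.
have := hsg 0; have := hsg 1; rewrite d0 d1 => h1 h0.
have pe : pval p e != 0 by rewrite gt_eqF ?(hyp_gt0 he).
have pa0 : pval p a != 0 by rewrite gt_eqF ?(epos_gt0 he pa).
by rewrite (permP (eigs_perm pe h0 hs)) (permP (eigs_perm pa0 h1 hs')).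
Qed.

(** All n eigenvalues of b in direction e are positive, hence by [inertia] also those in direction
    a. *)
Lemma epos_change a b : epos n p e a -> epos n p e b -> epos n p a b.
Proof.
move=> pa pb; have [s' hs'] := hyp_eigs (hyp_epos he pa) b; exists s' => //.
have pb0 := epos_gt0 he pb; case: pb => s hs spos.
have c := inertia pa (lt0r_neq0 pb0) hs hs'.
move: spos; rewrite !all_count c => /eqP ->.
by case: hs => -> _; case: hs' => ->.
Qed.

Lemma eigs_pval_neq0 x s T : eigs n p e x s -> T \notin s ->
  pval p (x - T *: e) != 0.
Proof.
move=> [_ h] Ts; rewrite -scaleNr h mulf_neq0 ?(gt_eqF (hyp_gt0 he)) //.
rewrite prodf_seq_neq0; apply/allP => l ls /=.
by rewrite addrC subr_eq0; apply: contraNneq Ts => <-.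
Qed.

(** If the k-th eigenvalue dropped, pick T strictly between the two values. In direction a, adding a
    to x - T e shifts every eigenvalue by 1, so the number of positive ones cannot decrease;
    [inertia] transfers this to direction e, a contradiction. *)
Let mono_pos a x s s' k : epos n p e a -> desc s -> desc s' ->
  eigs n p e x s -> eigs n p e (x + a) s' -> (k < n)%N ->
  nth 0 s k <= nth 0 s' k.
Proof.
move=> pa ds ds' hs hs' kn; rewrite leNgt; apply/negP => lt.
have [T [s'T Ts Tr]] := avoid_seq (s ++ s') lt.
move: Tr; rewrite mem_cat negb_or => /andP[Tns Tns'].
have px := eigs_pval_neq0 hs Tns; have px' := eigs_pval_neq0 hs' Tns'.
have [sg hsg] := hyp_eigs (hyp_epos he pa) (x - T *: e).
have hsg' := eigs_shift 1 hsg.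
have E : x - T *: e + 1 *: a = x + a - T *: e by rewrite scale1r addrAC.
rewrite E in hsg'.
have hsT := eigs_shift (- T) hs; have hsT' := eigs_shift (- T) hs'.
rewrite !scaleNr in hsT hsT'.
have c1 := inertia pa px hsT hsg; have c2 := inertia pa px' hsT' hsg'.
have sub : (count (> 0)%R sg <= count (> 0)%R [seq (l + 1)%R | l <- sg])%N.
  by rewrite count_map; apply: sub_count => l /= l0; rewrite addr_gt0.
have dT s0 : desc s0 -> desc [seq l + - T | l <- s0].
  by move=> d0; rewrite sorted_map; apply: sub_sorted d0 => y z /=; rewrite lerD2r.
have [sn _] := hs; have [sn' _] := hs'.
have k1 : (k < count (> 0)%R [seq (l + - T)%R | l <- s])%N.
  rewrite -desc_count ?size_map ?sn //; last exact: dT.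
  by rewrite (nth_map 0) ?sn // subr_gt0.
have : (k < count (> 0)%R [seq (l + - T)%R | l <- s'])%N.
  by rewrite c2 (leq_trans _ sub) // -c1.
rewrite -desc_count ?size_map ?sn' //; last exact: dT.
by rewrite (nth_map 0) ?sn' // subr_gt0 ltNge ltW.
Qed.

(** The positive case applies to a + eps e and yields the eigenvalues of x + a shifted by eps, for
    every eps > 0. *)
Lemma eigs_mono a x s s' k : enneg n p e a -> desc s -> desc s' ->
  eigs n p e x s -> eigs n p e (x + a) s' -> (k < n)%N ->
  nth 0 s k <= nth 0 s' k.
Proof.
move=> [sa hsa /allP sann] ds ds' hs hs' kn; apply/ler_addgt0Pr => eps e0.
have pa : epos n p e (a + eps *: e).
  exists [seq l + eps | l <- sa]; first exact: eigs_shift.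
  by apply/allP => _ /mapP[l /sann l0 ->] /=; rewrite ltr_wpDl.
have := eigs_shift eps hs'; rewrite -addrA => hs2.
have ds2 : desc [seq l + eps | l <- s'].
  by rewrite sorted_map; apply: sub_sorted ds' => y z /=; rewrite lerD2r.
have := mono_pos pa ds ds2 hs hs2 kn; rewrite (nth_map 0) //.
by case: hs' => ->.
Qed.

Lemma eigs_desc x : exists2 s, eigs n p e x s & desc s.
Proof.
have [s hs] := hyp_eigs he x; exists (sort (fun y z => z <= y) s).
  by apply: eigs_perm_eq hs; rewrite perm_sym perm_sort.
exact: desc_sort.
Qed.

Lemma eigs_all (P : pred R) x s s' : eigs n p e x s -> eigs n p e x s' ->
  all P s -> all P s'.
Proof.
move=> hs hs'; have pe : pval p e != 0 by rewrite gt_eqF ?(hyp_gt0 he).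
by rewrite (perm_all _ (eigs_perm pe hs hs')).
Qed.

(** Convexity of the cone follows from monotonicity: each ordered eigenvalue of a + b is at least
    that of a. *)
Lemma ennegD a b : enneg n p e a -> enneg n p e b -> enneg n p e (a + b).
Proof.
move=> [sa hsa sa0] nb; have [s hs ds] := eigs_desc a.
have [s' hs' ds'] := eigs_desc (a + b); exists s' => //.
have /(all_nthP 0) s0 := eigs_all hsa hs sa0.
have [[sn _] [sn' _]] := (hs, hs').
apply/(all_nthP 0) => i; rewrite sn' => iN.
by apply: le_trans (eigs_mono nb ds ds' hs hs' iN); apply: s0; rewrite sn.
Qed.

Lemma enneg0 : enneg n p e 0.
Proof.
exists (nseq n 0); first exact: eigs0 (hyp_homog he).
by apply/allP => l /nseqP[-> _] /=.
Qed.

Lemma ennegZ c a : 0 <= c -> enneg n p e a -> enneg n p e (c *: a).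
Proof.
rewrite le_eqVlt => /predU1P[<- _|c0]; first by rewrite scale0r; apply: enneg0.
move=> [s hs /allP s0]; exists [seq c * l | l <- s].
  exact: eigs_scale (hyp_homog he) c0 hs.
by apply/allP => _ /mapP[l /s0 l0 ->] /=; rewrite mulr_ge0 // ltW.
Qed.

Lemma enneg_sum (I : Type) (r : seq I) (P : pred I) (F : I -> 'rV[R]_m) :
  (forall i, P i -> enneg n p e (F i)) -> enneg n p e (\sum_(i <- r | P i) F i).
Proof. by move=> hF; apply: big_ind => //; [exact: enneg0|exact: ennegD]. Qed.

Lemma epos_enneg a : epos n p e a -> enneg n p e a.
Proof. by move=> [s hs s0]; exists s => //; apply: sub_all s0 => l; apply: ltW. Qed.

Lemma eposD a b : epos n p e a -> enneg n p e b -> epos n p e (a + b).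
Proof.
move=> [sa hsa sa0] nb; have [s hs ds] := eigs_desc a.
have [s' hs' ds'] := eigs_desc (a + b); exists s' => //.
have /(all_nthP 0) s0 := eigs_all hsa hs sa0.
have [[sn _] [sn' _]] := (hs, hs').
apply/(all_nthP 0) => i; rewrite sn' => iN.
by apply: lt_le_trans (eigs_mono nb ds ds' hs hs' iN); apply: s0; rewrite sn.
Qed.

Lemma eposZ c a : 0 < c -> epos n p e a -> epos n p e (c *: a).
Proof.
move=> c0 [s hs /allP s0]; exists [seq c * l | l <- s].
  exact: eigs_scale (hyp_homog he) c0 hs.
by apply/allP => _ /mapP[l /s0 l0 ->] /=; rewrite mulr_gt0.
Qed.

Lemma eigs_pval_nth x s : eigs n p e x s ->
  pval p x = pval p e * \prod_(k < n) nth 0 s k.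
Proof.
by move=> hs; rewrite (eigs_pval hs) (big_nth 0) big_mkord; case: hs => ->.
Qed.

Lemma pval_mono x a : enneg n p e x -> enneg n p e a ->
  pval p x <= pval p (x + a).
Proof.
move=> [sx hsx sx0] na; have [s hs ds] := eigs_desc x.
have [s' hs' ds'] := eigs_desc (x + a).
have /(all_nthP 0) s0 := eigs_all hsx hs sx0.
rewrite (eigs_pval_nth hs) (eigs_pval_nth hs') ler_wpM2l ?(ltW (hyp_gt0 he)) //.
apply: ler_prod => k _; rewrite (eigs_mono na ds ds' hs hs') // andbT.
by apply: s0; case: hs => ->.
Qed.

End Cone.

(** * Mixed derivatives *)

Lemma horner_prod_XaddC (K : fieldType) (s : seq K) z :
  (\prod_(c <- s) ('X + c%:P)).[z] = \prod_(c <- s) (z + c).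
Proof. by rewrite horner_prod; apply: eq_bigr => c _; rewrite !hornerE. Qed.

Lemma deriv_prod_XaddC (K : fieldType) (s : seq K) z :
  (forall c, c \in s -> z + c != 0) ->
  (\prod_(c <- s) ('X + c%:P))^`().[z]
  = \prod_(c <- s) (z + c) * \sum_(c <- s) (z + c)^-1.
Proof.
elim: s => [|c s IH] h; first by rewrite !big_nil derivC horner0 mulr0.
rewrite !big_cons derivM derivD derivX derivC addr0 mul1r hornerD hornerM.
rewrite IH => [|d ds]; last by apply: h; rewrite inE ds orbT.
rewrite horner_prod_XaddC hornerD hornerX hornerC.
have c0 := h c (mem_head _ _); by field.
Qed.

Lemma lead_deriv (R : numDomainType) (f : {poly R}) n :
  f \is monic -> size f = n.+2 ->
  size f^`() = n.+1 /\ lead_coef f^`() = n.+1%:R.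
Proof.
move=> /monicP f1 sf.
have c : f^`()`_n = n.+1%:R by rewrite coef_deriv -[RHS]/(1 *+ _) -f1 lead_coefE sf.
have sz : size f^`() = n.+1.
  apply/eqP; rewrite eqn_leq; apply/andP; split.
    rewrite -ltnS -sf; apply: lt_size_deriv.
    by rewrite -size_poly_eq0 sf.
  rewrite ltnNge; apply/negP => le; move: c; rewrite nth_default // => /eqP.
  by rewrite eq_sym pnatr_eq0.
by rewrite lead_coefE sz.
Qed.

(* Gauss-Lucas: off the real axis [f'/f] is a sum of terms whose imaginary parts
   have the same sign, and right of all roots it is a sum of positive terms. *)
Lemma deriv_real_rooted (R : realType) n (s : seq R) : size s = n.+1 ->
  exists s', [/\ size s' = n,
    (\prod_(l <- s) ('X + l%:P))^`() = n.+1%:R *: \prod_(l <- s') ('X + l%:P)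
    & all (> 0) s -> all (> 0) s'].
Proof.
move=> sn; set f := \prod_(l <- s) _.
have fE : f = \prod_(z <- map -%R s) ('X - z%:P) by rewrite prod_addE.
have fmon : f \is monic by rewrite fE monic_prod_XsubC.
have sf : size f = n.+2 by rewrite fE size_prod_XsubC size_map sn.
have [sf' lf'] := lead_deriv fmon sf.
have sne : s != [::] by rewrite -size_eq0 sn.
have ImD (x y : R[i]) : complex.Im (x + y) = complex.Im x + complex.Im y.
  by case: x y => [? ?] [? ?].
have [z rz|r hr] := @root_real_split R f^`().
  apply/eqP/negP => /negP Iz.
  have zc l : z + real_complex R l != 0.
    by apply: contraNneq Iz => /(congr1 (@complex.Im R)); rewrite ImD /= addr0 => ->.
  move: rz; rewrite -deriv_map /f rmorph_prod /=.
  under eq_bigr do rewrite rmorphD /= map_polyX map_polyC.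
  rewrite -(big_map (real_complex R) xpredT (fun c => 'X + c%:P)).
  rewrite rootE deriv_prod_XaddC => [|_ /mapP[l _ ->]//].
  rewrite mulf_eq0 => /orP[|/eqP].
    rewrite prodf_seq_eq0 => /hasP[_ /mapP[l _ ->]] /=.
    by rewrite (negPf (zc l)).
  rewrite big_map => /(congr1 (fun c => complex.Im z * complex.Im c)).
  rewrite mulr0 => /eqP; apply/negP; rewrite lt_eqF //.
  have t l : complex.Im z * complex.Im (z + real_complex R l)^-1 < 0.
    move: Iz (zc l); case: (z) => a b /= b0 _; rewrite mulrN oppr_lt0 addr0.
    rewrite mulrA divr_gt0 // -?expr2 ?exprn_even_gt0 ?orbT //=.
    by rewrite ltr_wpDl ?sqr_ge0 // exprn_even_gt0.
  case: (s) sne => // l s1 _; elim: s1 l => [|l' s1 IH] l.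
    by rewrite big_seq1.
  rewrite big_cons ImD mulrDr; have := IH l'; have := t l; lra.
exists (map -%R r); split.
- rewrite size_map; move: sf'; rewrite hr size_scale ?size_prod_XsubC => [[]//|].
  by rewrite lf' pnatr_eq0.
- rewrite hr lf' -prod_addE -map_comp (eq_map (g := id)) ?map_id // => x /=.
  by rewrite opprK.
- move=> /allP spos; apply/allP => _ /mapP[z zr ->] /=; rewrite oppr_gt0 ltNge.
  apply/negP => z0.
  have : f^`().[z] = 0.
    by apply/rootP; rewrite hr lf' rootZ ?pnatr_eq0 // root_prod_XsubC.
  have zl l : l \in s -> 0 < z + l by move=> /spos l0; rewrite ltr_wpDl.
  rewrite deriv_prod_XaddC => [|l /zl]; last by move=> /lt0r_neq0.
  apply/eqP; rewrite gt_eqF // mulr_gt0 //.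
    by rewrite big_seq; apply: prodr_gt0.
  case: (s) sne zl => // l s1 _ zl; rewrite big_cons ltr_pwDl //.
    by rewrite invr_gt0 zl ?mem_head.
  rewrite big_seq; apply: sumr_ge0 => l' ls; rewrite invr_ge0 ltW // zl //.
  by rewrite inE ls orbT.
Qed.

(** * Partial derivatives along a coordinate direction of hyperbolicity *)

Section PartialDerivative.
Variables (R : realType) (N : nat).
Implicit Types (q : {mpoly R[N]}) (x v : 'rV[R]_N).
Local Notation d_ i := (delta_mx 0 i : 'rV[R]_N).

(** Along the i-th coordinate direction only the i-th factor of each monomial varies. This reduces a
    partial derivative to the derivative of a real-rooted univariate polynomial. *)
Lemma lineR_mderiv q x i : (lineR q x (d_ i))^`() = lineR q^`M(i) x (d_ i).
Proof.
rewrite /lineR /lineK; set h := (fun j => _ + _).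
have hi : h i = (x ord0 i)%:P + 'X by rewrite /h mxE !eqxx scale1r.
have hj j : j != i -> h j = (x ord0 j)%:P.
  by move=> ji; rewrite /h mxE (negPf ji) andbF scale0r addr0.
elim/mpolyind: q => [|c k q _ _ IH].
  by rewrite mderiv0 !mmap0 derivC.
rewrite mderivD mderivZ mderivX !mmapD !mmapZ derivD IH; congr (_ + _).
rewrite /= !mmapX mul_polyC derivZ -mul_polyC; congr (_ * _).
have split k' : mmap1 h k' = h i ^+ k' i * \prod_(j | j != i) h j ^+ k' j.
  by rewrite /mmap1 (bigD1 i).
rewrite !split derivM.
have -> : (\prod_(j | j != i) h j ^+ k j)^`() = 0.
  rewrite (eq_bigr (fun j => (x ord0 j ^+ k j)%:P)); last first.
    by move=> j /hj ->; rewrite rmorphXn.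
  by rewrite -rmorph_prod derivC.
rewrite mulr0 addr0 hi deriv_exp derivD derivC derivX add0r mul1r.
rewrite mnmBE mnm1E eqxx subn1.
have -> : \prod_(j | j != i) h j ^+ (k - U_(i))%MM j
    = \prod_(j | j != i) h j ^+ k j.
  by apply: eq_bigr => j ji; rewrite mnmBE mnm1E eq_sym (negPf ji) subn0.
by rewrite mulrA polyC_natr mulr_natl.
Qed.

Lemma mderiv_homog q n i : q \is n.+1.-homog -> q^`M(i) \is n.-homog.
Proof.
move=> /dhomogP hq; apply/dhomogP => k; rewrite mcoeff_msupp mcoeff_deriv => nz.
have : (k + U_(i))%MM \in msupp q.
  by rewrite mcoeff_msupp; apply: contraNneq nz => ->; rewrite mul0rn.
by move=> /hq /=; rewrite mdegD mdeg1 addn1 => -[].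
Qed.

Section Step.
Variables (q : {mpoly R[N]}) (n : nat) (i : 'I_N).
Hypothesis hq : hyp n.+1 q (d_ i).

Lemma pval_mderiv_dir : pval q^`M(i) (d_ i) = n.+1%:R * pval q (d_ i).
Proof.
have [_ <-] := lineR_top 0 (d_ i) (mderiv_homog i (hyp_homog hq)).
rewrite -lineR_mderiv coef_deriv mulr_natl.
by have [_ <-] := lineR_top 0 (d_ i) (hyp_homog hq).
Qed.

Lemma eigs_mderiv x s : eigs n.+1 q (d_ i) x s ->
  exists2 s', eigs n q^`M(i) (d_ i) x s' & all (> 0) s -> all (> 0) s'.
Proof.
move=> hs; have [s' [sn' ds' pos']] := deriv_real_rooted hs.1.
exists s' => //; split=> // t.
rewrite -horner_lineR -lineR_mderiv (eigs_lineR hs) derivZ ds' scalerA hornerZ.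
by rewrite pval_mderiv_dir [pval _ _ * _]mulrC horner_prod_XaddC.
Qed.

Lemma hyp_mderiv : hyp n q^`M(i) (d_ i).
Proof.
split; first exact: mderiv_homog (hyp_homog hq).
  by rewrite pval_mderiv_dir mulr_gt0 ?ltr0n ?(hyp_gt0 hq).
by move=> x; have [s /eigs_mderiv[s' hs' _]] := hyp_eigs hq x; exists s'.
Qed.

Lemma epos_mderiv x : epos n.+1 q (d_ i) x -> epos n q^`M(i) (d_ i) x.
Proof. by move=> [s /eigs_mderiv[s' hs' h] /h s'0]; exists s'. Qed.

Lemma pval_mderiv x s : eigs n.+1 q (d_ i) x s ->
  pval q^`M(i) x = pval q (d_ i) * (\prod_(l <- s) ('X + l%:P))^`().[0].
Proof.
move=> hs; rewrite -hornerZ -derivZ -(eigs_lineR hs) lineR_mderiv horner_lineR.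
by rewrite scale0r addr0.
Qed.

End Step.
End PartialDerivative.

(** The derivative at 0 is the coefficient of t in the expansion of prod (t + l), all of whose terms
    are nonnegative. *)
Lemma deriv0_lower (R : realType) (s : seq R) t : all (>= 0) s -> 0 <= t ->
  0 <= (\prod_(l <- s) ('X + l%:P))^`().[0] /\
  t * (\prod_(l <- s) ('X + l%:P))^`().[0] <= \prod_(l <- s) (t + l).
Proof.
move=> + t0; elim: s => [|l s IH]; first by rewrite !big_nil derivC horner0 mulr0.
move=> /= /andP[l0 s0]; have [E0 tE] := IH s0; rewrite !big_cons.
rewrite derivM derivD derivX derivC addr0 mul1r hornerD hornerM.
set E := _^`().[0] in E0 tE *; rewrite horner_prod_XaddC hornerD hornerX hornerC add0r.
under eq_bigr do rewrite add0r.
have P0 : 0 <= \prod_(c <- s) c by rewrite big_seq; apply: prodr_ge0 => c /(allP s0).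
have Pt : \prod_(c <- s) c <= \prod_(c <- s) (t + c).
  by rewrite big_seq [leRHS]big_seq; apply: ler_prod => c /(allP s0) /= c0; lra.
split; first by rewrite addr_ge0 // mulr_ge0.
rewrite mulrDr mulrDl lerD ?ler_wpM2l // mulrCA ler_wpM2l //.
Qed.

(* With [t = 1 / sum (1 / l)] every factor [t + l] is at most [2 l]. *)
Lemma deriv0_upper (R : realType) (s : seq R) (C g : R) :
  0 <= g -> s != [::] -> all (> 0) s ->
  (forall t, 0 < t -> C * t <= g * \prod_(l <- s) (t + l)) ->
  C <= 2 ^+ size s * (g * (\prod_(l <- s) ('X + l%:P))^`().[0]).
Proof.
move=> g0 sne /allP spos hC.
rewrite deriv_prod_XaddC => [|l /spos l0]; last by rewrite add0r gt_eqF.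
under eq_bigr do rewrite add0r; under [\sum_(c <- s) _]eq_bigr do rewrite add0r.
set P := \prod_(l <- s) l; set S := \sum_(l <- s) _.
have V0 l : l \in s -> 0 < l^-1 by move=> /spos; rewrite invr_gt0.
have Sl l : l \in s -> l^-1 <= S.
  move=> ls; rewrite /S (big_rem l ls) /= lerDl big_seq; apply: sumr_ge0 => c.
  by move=> /mem_rem /V0 /ltW.
have S0 : 0 < S.
  case: (s) sne V0 Sl => // l s' _ V0 Sl.
  by apply: lt_le_trans (Sl l _); rewrite ?V0 ?mem_head.
have t0 : 0 < S^-1 by rewrite invr_gt0.
have := hC _ t0.
have : \prod_(l <- s) (S^-1 + l) <= 2 ^+ size s * P.
  rewrite prodr_scale big_seq [leRHS]big_seq; apply: ler_prod => l ls.
  have l0 := spos _ ls; have : S^-1 <= l by rewrite invf_ple ?posrE // Sl.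
  by rewrite /= in l0; lra.
move=> le1 le2; rewrite -(ler_pM2r t0); apply: le_trans le2 _.
have -> : 2 ^+ size s * (g * (P * S)) / S = g * (2 ^+ size s * P).
  by field; rewrite gt_eqF.
exact: ler_wpM2l.
Qed.

(** The constant 2^(d (d + 1) / 2): the derivative step in degree k costs a factor 2^k, for k = d,
    ..., 1. *)
Fixpoint capK (R : realType) (d : nat) : R :=
  if d is d'.+1 then 2 ^+ d * capK R d' else 1.

Lemma capK_gt0 (R : realType) d : 0 < capK R d.
Proof. by elim: d => //= d IH; rewrite mulr_gt0 // exprn_gt0. Qed.

(** * Capacity bounds for iterated derivatives *)

Section MixedDerivative.
Variables (R : realType) (N : nat).
Implicit Types (q : {mpoly R[N]}) (J : seq 'I_N) (al : 'I_N -> R).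
Local Notation d_ i := (delta_mx 0 i : 'rV[R]_N).

(** The point with coordinates [al] on J and 0 elsewhere: variables already differentiated have left
    the list and are set to 0. *)
Definition vec J al : 'rV[R]_N := \sum_(j <- J) al j *: d_ j.

Lemma foldr_mderiv q i J :
  foldr (@mderiv N R) q (i :: J) = foldr (@mderiv N R) q^`M(i) J.
Proof. by elim: J => //= j J <- /=; rewrite mderiv_comm. Qed.

Definition mixed q J := pval (foldr (@mderiv N R) q J) 0.

(** For nonempty J the vector is a sum of positive ones. For empty J it is 0 in degree 1, whence the
    exceptional list [[:: 0]]. *)
Let vec_eigs q e J i al : hyp (size (i :: J)) q e ->
  (forall j, j \in i :: J -> epos (size (i :: J)) q e (d_ j)) ->
  (forall j, 0 < al j) ->
  exists2 s, eigs (size (i :: J)) q (d_ i) (vec J al) s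
    & all (> 0) s \/ s = [:: 0].
Proof.
move=> he hJ al0; have pi := hJ i (mem_head _ _); have hi := hyp_epos he pi.
have posJ j : j \in J -> epos (size (i :: J)) q (d_ i) (al j *: d_ j).
  move=> jJ; apply: (eposZ hi) => //; apply: (epos_change he pi); apply: hJ.
  by rewrite inE jJ orbT.
case: J posJ he hJ pi hi => [|j J] posJ he hJ pi hi.
  exists [:: 0]; last by right.
  by rewrite /vec big_nil; apply: eigs0 (hyp_homog he).
have [|s hs s0] :=
  @eposD _ _ _ _ _ hi (al j *: d_ j) (vec J al) (posJ j (mem_head _ _)).
  rewrite /vec big_seq; apply: (enneg_sum hi) => k kJ; apply: epos_enneg.
  by apply: posJ; rewrite inE kJ orbT.
by exists s; [rewrite /vec big_cons|left].
Qed.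

(** Induction on J: by [deriv0_lower], the value at al_i d_i + v is at least al_i times the i-th
    derivative at v, and that derivative is hyperbolic in direction d_i. *)
Lemma mixed_le q e J al : hyp (size J) q e ->
  (forall j, j \in J -> epos (size J) q e (d_ j)) -> (forall j, 0 < al j) ->
  mixed q J * \prod_(j <- J) al j <= pval q (vec J al).
Proof.
elim: J q e => [|i J IH] q e he hJ al0; first by rewrite /mixed /vec !big_nil mulr1.
have pi := hJ i (mem_head _ _); have hi := hyp_epos he pi.
have [s hs s0] := vec_eigs he hJ al0.
have s_ge0 : all (>= 0) s.
  by case: s0 => [|-> /=]; [apply: sub_all => l; apply: ltW|rewrite lexx].
have hJ' j : j \in J -> epos (size J) q^`M(i) (d_ i) (d_ j).
  move=> jJ; apply: (epos_mderiv hi); apply: (epos_change he pi).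
  by apply: hJ; rewrite inE jJ orbT.
have := IH _ _ (hyp_mderiv hi) hJ' al0; rewrite (pval_mderiv hs) => le1.
have [_ le2] := deriv0_lower s_ge0 (ltW (al0 i)).
rewrite /mixed foldr_mderiv -/(mixed _ _) /vec !big_cons -/(vec _ _) addrC.
case: (hs) => _ ->; rewrite mulrCA.
apply: le_trans (ler_wpM2l (ltW (al0 i)) le1) _.
by rewrite mulrCA ler_wpM2l // ltW // (hyp_gt0 hi).
Qed.

(** Induction on J: the assumed bound, with the weight t of the first variable free, gives through
    [deriv0_upper] the same kind of bound for the derivative, with c divided by 2^(size J + 1). *)
Lemma mixed_ge q e J c : uniq J -> hyp (size J) q e ->
  (forall j, j \in J -> epos (size J) q e (d_ j)) ->
  (forall al, (forall j, 0 < al j) ->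
     c * \prod_(j <- J) al j <= pval q (vec J al)) ->
  c <= capK R (size J) * mixed q J.
Proof.
elim: J q e c => [|i J IH] q e c uJ he hJ hc.
  have := hc (fun=> 1) (fun=> ltr01).
  by rewrite /mixed /vec !big_nil mulr1 mul1r.
move: uJ => /= /andP[iJ uJ].
have pi := hJ i (mem_head _ _); have hi := hyp_epos he pi.
have hJ' j : j \in J -> epos (size J) q^`M(i) (d_ i) (d_ j).
  move=> jJ; apply: (epos_mderiv hi); apply: (epos_change he pi).
  by apply: hJ; rewrite inE jJ orbT.
have K0 : 0 < 2 ^+ (size J).+1 :> R by rewrite exprn_gt0.
rewrite -mulrA -ler_pdivrMl // /mixed foldr_mderiv -/(mixed _ _).
apply: (IH _ _ _ uJ (hyp_mderiv hi) hJ') => al al0.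
have [s hs s0] := vec_eigs he hJ al0.
rewrite (pval_mderiv hs) -mulrA ler_pdivrMl //.
have hC t : 0 < t ->
    c * \prod_(j <- J) al j * t <= pval q (d_ i) * \prod_(l <- s) (t + l).
  (* Only the weight of i is changed to t; as i is not in J, the weights on J stay. *)
  move=> t0; pose al' j := if j == i then t else al j.
  have al'E j : j \in J -> al' j = al j.
    by move=> jJ; rewrite /al'; case: eqP => // ji; rewrite -ji jJ in iJ.
  have al'i : al' i = t by rewrite /al' eqxx.
  have al'0 j : 0 < al' j by rewrite /al'; case: eqP.
  have := hc al' al'0; rewrite /vec !big_cons al'i.
  rewrite [\prod_(j <- J) _]big_seq (eq_bigr al) // -big_seq.
  rewrite [\sum_(j <- J) _]big_seq (eq_bigr (fun j => al j *: d_ j)); last first.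
    by move=> j jJ; rewrite al'E.
  rewrite -big_seq -/(vec _ _) addrC; case: (hs) => _ -> h.
  by rewrite -mulrA [_ * t]mulrC.
have [sn _] := hs; case: s0 => [s_gt0|s0].
  rewrite -[(size J).+1]sn; apply: deriv0_upper => //.
    by rewrite ltW // (hyp_gt0 hi).
  by rewrite -size_eq0 sn.
(* In the exceptional degree 1 case the derivative is 1, and t = 1 already gives the bound. *)
have := hC 1 ltr01; rewrite s0 !big_seq1 mulr1 addr0 mulr1 derivD derivX derivC.
rewrite addr0 hornerC mulr1 => le; apply: le_trans le _.
by rewrite ler_peMl ?(ltW (hyp_gt0 hi)) // exprn_ege1 // ler1n.
Qed.

End MixedDerivative.

(** * Pencils and perturbation *)

Lemma dvdp_prod_mup (F : fieldType) (f : {poly F}) (s : seq F) :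
  f != 0 -> uniq s -> \prod_(a <- s) ('X - a%:P) ^+ mup a f %| f.
Proof.
move=> f0; elim: s => [|a s IH] /=; first by rewrite big_nil dvd1p.
move=> /andP[as_ us]; rewrite big_cons Gauss_dvdp ?IH ?andbT -?mup_geq //.
rewrite coprimep_expl // coprimep_sym coprimep_XsubC rootE horner_prod.
rewrite prodf_seq_neq0; apply/allP => b bs /=.
rewrite horner_exp expf_neq0 // hornerXsubC subr_eq0.
by apply: contraNneq as_ => ->.
Qed.

(** * From the defining root lists to eigenvalue lists *)

Section FromDefs.
Variables (R : realType) (m n : nat) (p : {mpoly R[m]}) (e : 'rV[R]_m).
Hypotheses (p_homog : p \is n.-homog) (p_hyp : hyperbolic n p e).
Implicit Type x : 'rV[R]_m.

Lemma line_polyE x : line_poly p e x = lineR p x (- e).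
Proof.
rewrite /line_poly /lineR /lineK; congr mmap.
by apply: funext => j; rewrite mxE scaleNr.
Qed.

Lemma roots_mult_desc x : desc (roots_mult (line_poly p e x)).
Proof. exact: desc_sort. Qed.

(** The product over the listed roots divides the line polynomial and already has degree n, so the
    quotient is a constant, read off in degree n as p (- e). *)
Lemma roots_mult_eigs x : eigs n p e x (roots_mult (line_poly p e x)).
Proof.
have [L0 sn] := p_hyp x; split=> // t.
set L := line_poly p e x in L0 sn *; set r := roots_mult L in sn *.
have [sL Ln] := lineR_top x (- e) p_homog; rewrite -line_polyE -/L in sL Ln.
have rE : \prod_(a <- r) ('X - a%:P) = \prod_(a <- rootsR L) ('X - a%:P) ^+ mup a L.
  rewrite /r /roots_mult (perm_big _ (permEl (perm_sort _ _))) /=.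
  rewrite big_flatten big_map; apply: eq_bigr => a _.
  by rewrite big_nseq iter_mulr_1.
have : \prod_(a <- r) ('X - a%:P) %| L by rewrite rE dvdp_prod_mup // uniq_roots.
move=> /dvdpP[Q LQ].
have Q0 : Q != 0 by apply: contraNneq L0 => Q0; rewrite LQ Q0 mul0r.
have P1 := monic_prod_XsubC r xpredT id.
have sQ : (size Q <= 1)%N.
  move: sL; rewrite LQ size_Mmonic // size_prod_XsubC sn.
  by rewrite addnS /= -add1n leq_add2r.
rewrite (size1_polyC sQ) in LQ; set c := Q`_0 in LQ.
have cE : c = pval p (- e).
  rewrite -Ln LQ coefCM; have /monicP := P1.
  by rewrite lead_coefE size_prod_XsubC sn /= => ->; rewrite mulr1.
have -> : pval p (x + t *: e) = L.[- t].
  by rewrite /L line_polyE horner_lineR scaleNr scalerN opprK.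
rewrite LQ hornerM hornerC horner_prod_XsubC cE -scaleN1r (pvalZ _ _ p_homog).
rewrite mulrAC mulrC -sn prodr_scale; congr (_ * _).
by apply: eq_bigr => l _; ring.
Qed.

Lemma hyperbolic_hyp : 0 < pval p e -> hyp n p e.
Proof.
move=> pe; split=> // x; exists (roots_mult (line_poly p e x)).
exact: roots_mult_eigs.
Qed.

Lemma e_nonnegative_enneg x : e_nonnegative n p e x -> enneg n p e x.
Proof.
rewrite /e_nonnegative /lambda => h; exists (roots_mult (line_poly p e x)).
  exact: roots_mult_eigs.
have [sn _] := roots_mult_eigs x; apply/(all_nthP 0) => i; rewrite sn => iN.
apply: le_trans h _; apply: (desc_nth (roots_mult_desc x)); rewrite ?sn.
  by rewrite -ltnS prednK // (leq_ltn_trans _ iN).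
by rewrite prednK // (leq_ltn_trans _ iN).
Qed.

Lemma p_rank_count x :
  p_rank n p e x = count (predC1 0) (roots_mult (line_poly p e x)).
Proof.
rewrite /p_rank /lambda; have [sn _] := roots_mult_eigs x.
rewrite cardsE -sum1_card -sum1_count (big_nth 0) sn big_mkord.
by apply: eq_bigl => i.
Qed.

End FromDefs.

Lemma meval_at0 (R : realType) (n : nat) (q : {mpoly R[n]}) :
  q.@[fun=> 0] = q@_0%MM.
Proof.
rewrite mevalE {3}[q]mpolyE raddf_sum /=; apply: eq_bigr => k _.
rewrite mcoeffZ mcoeffX; congr (_ * _); have [->|k0] := eqVneq k 0%MM.
  by rewrite big1 // => i _; rewrite mnm0E.
have [i ki] : exists i, k i != 0%N.
  apply/existsP; rewrite -negb_forall; apply: contra k0 => /forallP h.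
  by apply/eqP/mnmP => i; rewrite mnm0E; apply/eqP/h.
by rewrite (bigD1 i) //= expr0n (negPf ki) mul0r.
Qed.

(** * Hyperbolic pencils and continuity of the mixed form *)

Section Perturbation.
Variables (R : realType) (m n : nat).
Implicit Types (p : {mpoly R[m]}) (x y : 'I_n -> 'rV[R]_m).
Let hN := absolute_value_normr R.

Definition lin y (v : 'rV[R]_n) : 'rV[R]_m := \sum_i v ord0 i *: y i.

Lemma pval_pencil p y v : pval (pencil p y) v = pval p (lin y v).
Proof.
rewrite /pval /pencil comp_mpoly_meval; apply: meval_eq => j.
rewrite tnth_mktuple /lin summxE raddf_sum; apply: eq_bigr => i _.
by rewrite /= mevalZ mevalXU mxE mulrC.
Qed.

Lemma pencil_homog p d y : p \is d.-homog -> pencil p y \is d.-homog.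
Proof.
move=> /dhomogP hp; rewrite /pencil /comp_mpoly /mmap big_seq; apply: rpred_sum.
move=> k /hp /= kn; rewrite mul_mpolyC; apply: dhomogZ; rewrite -kn mdegE /mmap1.
apply: (big_ind2 (fun (q : {mpoly R[n]}) c => q \is c.-homog)).
- exact: dhomog1.
- by move=> q c q' c' h h'; apply: dhomogM.
- move=> j _; rewrite tnth_mktuple -[X in X.-homog]mul1n; apply: dhomogMn.
  by apply: rpred_sum => i _; apply: dhomogZ; rewrite dhomogX /= mdeg1.
Qed.

Lemma linD y v w : lin y (v + w) = lin y v + lin y w.
Proof. by rewrite /lin -big_split /=; apply: eq_bigr => i _; rewrite mxE scalerDl. Qed.

Lemma linZ y c v : lin y (c *: v) = c *: lin y v.
Proof. by rewrite /lin scaler_sumr; apply: eq_bigr => i _; rewrite mxE scalerA. Qed.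

Lemma lin_delta y i : lin y (delta_mx 0 i) = y i.
Proof.
rewrite /lin (bigD1 i) //= mxE !eqxx scale1r big1 ?addr0 // => j ji.
by rewrite mxE (negPf ji) andbF scale0r.
Qed.

Lemma lin_vec y (al : 'I_n -> R) : lin y (vec (enum 'I_n) al) = \sum_i al i *: y i.
Proof.
rewrite /vec big_enum /=.
have -> : \sum_(i < n) al i *: delta_mx 0 i = \row_i al i :> 'rV[R]_n.
  by rewrite [RHS]row_sum_delta; apply: eq_bigr => i _; rewrite mxE.
by apply: eq_bigr => i _; rewrite mxE.
Qed.

Lemma mixed_formE p y : mixed_form p y = mixed (pencil p y) (enum 'I_n).
Proof.
rewrite /mixed_form /mixed /pval.
rewrite (meval_eq _ (_ : _ =1 fun=> 0)); last by move=> j; rewrite mxE.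
congr meval; rewrite /mderivm; elim: (enum _) => //= i s ->.
by rewrite mnmE.
Qed.

(** The map [lin y] sends lines in direction [delta_mx 0 i] to lines in direction y_i, so eigenvalue
    lists carry over. For n = 0 there is no basis vector, but the polynomial is a positive constant
    and the direction 0 serves. *)
Lemma pencil_hyp p e y : hyp n p e -> (forall i, epos n p e (y i)) ->
  exists2 e', hyp n (pencil p y) e'
    & forall i, epos n (pencil p y) e' (delta_mx 0 i).
Proof.
move=> he py; have hp := hyp_homog he.
have eigsT i v s : eigs n p (y i) (lin y v) s ->
    eigs n (pencil p y) (delta_mx 0 i) v s.
  by move=> [sn h]; split=> // t; rewrite !pval_pencil linD linZ lin_delta h.
have [n0|n0] := posnP n.
  have q0 v : pval (pencil p y) v = pval p e.
    have c w : pval p w = pval p 0.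
      by rewrite -(scale0r w) (pvalZ _ _ hp) n0 expr0 mul1r.
    by rewrite pval_pencil c [RHS]c.
  exists 0 => [|i]; last by have := ltn_ord i; rewrite {2}n0.
  split; rewrite ?q0 ?(hyp_gt0 he) ?pencil_homog // => v.
  by exists [::]; split=> // t; rewrite !q0 big_nil mulr1.
pose i := Ordinal n0; have hi := hyp_epos he (py i).
exists (delta_mx 0 i).
  split; first exact: pencil_homog.
    by rewrite pval_pencil lin_delta (hyp_gt0 hi).
  by move=> v; have [s /eigsT] := hyp_eigs hi (lin y v); exists s.
move=> j; have [s hs s0] := epos_change he (py i) (py j).
by exists s => //; apply: eigsT; rewrite lin_delta.
Qed.

(** Up to a factor c independent of t, the mixed form is the coefficient of alpha_1 ... alpha_n in
    the pencil, and coefficients arise by sums and products from the entries of x_i + t e. *)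
Lemma cont_mixed_form p x (e : 'rV[R]_m) :
  cont Num.norm (fun t => mixed_form p (fun i => x i + t *: e)).
Proof.
pose cm (F : R -> {mpoly R[n]}) := forall k, cont Num.norm (fun t => (F t)@_k).
have cmM F G : cm F -> cm G -> cm (fun t => F t * G t).
  move=> cF cG k.
  apply: eq_cont (_ : cont _ (fun t => \sum_(l : 'X_{1..n < (mdeg k).+1, (mdeg k).+1}
    | k == (l.1 + l.2)%MM) (F t)@_l.1 * (G t)@_l.2)).
    by move=> t; rewrite mcoeffM.
  by apply: (cont_sum hN) => l; apply: (contM hN).
have cmC q : cm (fun=> q) by move=> k; apply: cont_cst.
have cmX F d : cm F -> cm (fun t => F t ^+ d).
  move=> cF; elim: d => [|d IH]; first exact: cmC.
  by move=> k; apply: eq_cont (cmM _ _ cF IH k) => t; rewrite exprS.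
have cmS (I : Type) (r : seq I) (F : I -> R -> {mpoly R[n]}) :
    (forall i, cm (F i)) -> cm (fun t => \sum_(i <- r) F i t).
  move=> cF k; apply: eq_cont (_ : cont _ (fun t => \sum_(i <- r) (F i t)@_k)).
    by move=> t; rewrite raddf_sum.
  by apply: (cont_sum hN) => i; apply: cF.
have cmP (I : Type) (r : seq I) (F : I -> R -> {mpoly R[n]}) :
    (forall i, cm (F i)) -> cm (fun t => \prod_(i <- r) F i t).
  move=> cF; elim: r => [|i r IH] k.
    by apply: eq_cont (cmC 1 k) => t; rewrite big_nil.
  by apply: eq_cont (cmM _ _ (cF i) IH k) => t; rewrite big_cons.
pose F t := pencil p (fun i => x i + t *: e).
have cF : cm F.
  apply: cmS => k; apply: cmM; first exact: cmC.
  apply: cmP => j; apply: cmX => l.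
  apply: eq_cont (_ : cont _ (fun t => \sum_(i < n)
    (x i ord0 j + t * e ord0 j) * ('X_i : {mpoly R[n]})@_l)).
    move=> t; rewrite tnth_mktuple raddf_sum; apply: eq_bigr => i _.
    by rewrite /= mcoeffZ !mxE.
  apply: (cont_sum hN) => i; apply: (contM hN); last exact: cont_cst.
  apply: (contD hN); first exact: cont_cst.
  by apply: (contM hN); [move=> u eps e0; exists eps|exact: cont_cst].
set one := [multinom 1%N | i < n].
set c := (\prod_(i < n) ((one + 0)%MM i) ^_ (one i))%N.
apply: eq_cont (_ : cont _ (fun t => (F t)@_(one + 0)%MM * c%:R)).
  by move=> t; rewrite /mixed_form meval_at0 mcoeff_mderivm mulr_natr.
by apply: (contM hN); [exact: cF|exact: cont_cst].
Qed.

Lemma cont_pval p (v w : 'rV[R]_m) : cont Num.norm (fun t => pval p (v + t *: w)).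
Proof.
apply: eq_cont (_ : cont _ (fun t => \sum_(i < size (lineR p v w))
    (lineR p v w)`_i * t ^+ i)).
  by move=> t; rewrite -horner_lineR horner_coef.
apply: (cont_sum hN) => i; apply: (contM hN); first exact: cont_cst.
by apply: (contX hN) => u eps e0; exists eps.
Qed.

Lemma cont_ge0_right (f : R -> R) :
  cont Num.norm f -> (forall t, 0 < t -> 0 <= f t) -> 0 <= f 0.
Proof.
move=> cf f0; rewrite leNgt; apply/negP => lt.
have lt' : 0 < - f 0 by rewrite oppr_gt0.
have [d d0 fd] := cf 0 _ lt'.
have d2 : 0 < d / 2 by rewrite divr_gt0.
have := fd (d / 2); rewrite subr0 gtr0_norm // ltr_norml.
move=> /(_ _) h; have := f0 _ d2.
have /h /andP[_] : d / 2 < d by lra.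
lra.
Qed.

End Perturbation.

(** * The rank condition *)

Section Bounds.
Variables (R : realType) (m n : nat) (p : {mpoly R[m]}) (e : 'rV[R]_m).
Variable x : 'I_n -> 'rV[R]_m.
Hypotheses (he : hyp n p e) (hx : forall i, enneg n p e (x i)).
Implicit Types (al : 'I_n -> R) (S : {set 'I_n}).
Let xt t i := x i + t *: e.

Lemma epos_perturb t i : 0 < t -> epos n p e (xt t i).
Proof.
move=> t0; rewrite /xt addrC; apply: eposD => //.
by apply: eposZ => //; apply: epos_dir.
Qed.

Lemma sum_perturb al t :
  \sum_i al i *: xt t i = \sum_i al i *: x i + t *: ((\sum_i al i) *: e).
Proof.
rewrite scaler_suml scaler_sumr -big_split /=; apply: eq_bigr => i _.
by rewrite scalerDr !scalerA mulrC.
Qed.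

Lemma enneg_comb al : (forall i, 0 <= al i) -> enneg n p e (\sum_i al i *: x i).
Proof. by move=> al0; apply: (enneg_sum he) => i _; apply: ennegZ. Qed.

(** The bound holds for the e-positive vectors x_i + t e, t > 0; both sides are continuous in t. *)
Lemma mixed_form_le al : (forall i, 0 < al i) ->
  mixed_form p x * \prod_i al i <= pval p (\sum_i al i *: x i).
Proof.
move=> al0; rewrite -subr_ge0; set s := \sum_i al i.
pose f t := pval p (\sum_i al i *: x i + t *: (s *: e))
  - mixed_form p (xt t) * \prod_i al i.
have hN := absolute_value_normr R.
have cf : cont Num.norm f.
  apply: eq_cont (contD hN (cont_pval p (\sum_i al i *: x i) (s *: e))
    (contM hN (cont_mixed_form p x e) (cont_cst hN (- \prod_i al i)))) => t.
  by rewrite mulrN.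
have := cont_ge0_right cf.
rewrite /f scale0r addr0 (_ : xt 0 = x); last first.
  by apply: funext => i; rewrite /xt scale0r addr0.
apply=> t t0; rewrite subr_ge0 mixed_formE -sum_perturb -lin_vec -pval_pencil.
have [e' he' pos'] := pencil_hyp he (fun i => epos_perturb i t0).
have -> : \prod_i al i = \prod_(i <- enum 'I_n) al i by rewrite big_enum.
by apply: (mixed_le (e := e')) => //; rewrite size_enum_ord.
Qed.

(** By [pval_mono] the vectors x_i + t e satisfy the hypothesis with the same c, so the positive
    case applies for all t > 0 and t tends to 0. *)
Lemma mixed_form_ge c :
  (forall al, (forall i, 0 < al i) ->
     c * \prod_i al i <= pval p (\sum_i al i *: x i)) ->
  c <= capK R n * mixed_form p x.
Proof.
move=> hc; rewrite -subr_ge0; pose f t := capK R n * mixed_form p (xt t) - c.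
have hN := absolute_value_normr R.
have cf : cont Num.norm f.
  apply: (contD hN); last exact: cont_cst.
  by apply: (contM hN); [exact: cont_cst|exact: cont_mixed_form].
have := cont_ge0_right cf; rewrite /f (_ : xt 0 = x); last first.
  by apply: funext => i; rewrite /xt scale0r addr0.
apply=> t t0; rewrite subr_ge0 mixed_formE.
have [e' he' pos'] := pencil_hyp he (fun i => epos_perturb i t0).
rewrite -{1}[n]size_enum_ord.
apply: (mixed_ge (e := e')); rewrite ?size_enum_ord ?enum_uniq //.
move=> al al0; rewrite pval_pencil lin_vec sum_perturb big_enum /=.
apply: le_trans (hc al al0) _; apply: (pval_mono he).
  by apply: enneg_comb => i; apply: ltW.
rewrite scalerA; apply: (ennegZ he); last exact/epos_enneg/epos_dir.
by rewrite mulr_ge0 ?(ltW t0) // sumr_ge0 // => i _; apply: ltW.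
Qed.

(* Order the weights decreasingly; the k-th eigenvalue of the combination
   dominates that of the k-th largest weight times the sum over the k heaviest
   indices. *)
Lemma pval_comb_ge (lam : {set 'I_n} -> seq R) kap al :
  0 <= kap ->
  (forall S, eigs n p e (\sum_(i in S) x i) (lam S)) ->
  (forall S, desc (lam S)) ->
  (forall S k, (k < #|S|)%N -> kap <= nth 0 (lam S) k) ->
  (forall i, 0 < al i) ->
  pval p e * kap ^+ n * \prod_i al i <= pval p (\sum_i al i *: x i).
Proof.
move=> kap0 hlam dlam lamk al0; set u := \sum_i _.
have [su hsu dsu] := eigs_desc he u.
pose sg := sort (fun i j => al j <= al i) (enum 'I_n).
pose A := map al sg.
have psg : perm_eq sg (enum 'I_n) by rewrite perm_sort.
have ssg : size sg = n by rewrite (perm_size psg) size_enum_ord.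
have usg : uniq sg by rewrite (perm_uniq psg) enum_uniq.
have dA : desc A.
  by rewrite sorted_map; apply: sort_sorted => i j; apply: le_total.
have sA : size A = n by rewrite size_map.
have A0 k : (k < n)%N -> 0 < nth 0 A k.
  have /(all_nthP 0) h : all (> 0) A by apply/allP => _ /mapP[i _ ->] /=.
  by rewrite -sA; apply: h.
have key k : (k < n)%N -> kap * nth 0 A k <= nth 0 su k.
  (* As k counts from 0, S holds the k + 1 heaviest indices, and [nth 0 A k] is the least weight in
     S. *)
  move=> kn; pose S := [set i in take k.+1 sg].
  have cS : #|S| = k.+1.
    rewrite cardsE; have /card_uniqP -> : uniq (take k.+1 sg) by rewrite take_uniq.
    by rewrite size_takel // ssg.
  (* The weights left after removing that least weight from each index of S are nonnegative, so the
     remainder is an e-nonnegative vector and [eigs_mono] applies. *)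
  pose c i := al i - (if i \in S then nth 0 A k else 0).
  have c0 i : 0 <= c i.
    rewrite /c; case: ifP => [|_]; last by rewrite subr0 ltW.
    rewrite inE => iS; rewrite subr_ge0.
    have isg : i \in sg := mem_take iS.
    have lt : (index i sg < k.+1)%N.
      have := iS; rewrite -index_mem size_takel ?ssg //.
      by rewrite -{2}(cat_take_drop k.+1 sg) index_cat iS.
    have -> : al i = nth 0 A (index i sg).
      by rewrite /A (nth_map i) ?index_mem // nth_index.
    by apply: (desc_nth dA); rewrite ?sA.
  have uE : u = nth 0 A k *: (\sum_(i in S) x i) + \sum_i c i *: x i.
    rewrite scaler_sumr big_mkcond -big_split /=; apply: eq_bigr => i _.
    rewrite /c; case: ifP => _; rewrite ?subr0 ?add0r //.
    by rewrite -scalerDl addrC subrK.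
  have hS := eigs_scale (hyp_homog he) (A0 k kn) (hlam S).
  have dS : desc [seq nth 0 A k * l | l <- lam S].
    rewrite sorted_map; apply: sub_sorted (dlam S) => y z /= yz.
    by rewrite ler_wpM2l // ltW // A0.
  have hu := hsu; rewrite uE in hu.
  have := eigs_mono he (enneg_comb c0) dS dsu hS hu kn.
  rewrite (nth_map 0); last by case: (hlam S) => ->.
  apply: le_trans; rewrite mulrC ler_wpM2l ?lamk ?cS //.
  by rewrite ltW // A0.
rewrite (eigs_pval_nth hsu) -mulrA ler_wpM2l ?(ltW (hyp_gt0 he)) //.
have -> : \prod_i al i = \prod_(k < n) nth 0 A k.
  rewrite -(big_mkord xpredT (fun k => nth 0 A k)).
  have := big_nth 0 (idx := 1) (op := *%R) (r := A) xpredT id.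
  by rewrite sA => <-; rewrite /A big_map (perm_big _ psg) /= big_enum.
have -> : kap ^+ n = \prod_(k < n) kap by rewrite prodr_const card_ord.
rewrite -big_split /=; apply: ler_prod => k _; rewrite key //.
by rewrite mulr_ge0 // ltW // A0.
Qed.

Lemma dominate (v : 'rV[R]_m) : exists2 C, 0 < C & enneg n p e (v + C *: e).
Proof.
have [s hs] := hyp_eigs he v; exists (1 + \sum_(l <- s) `|l|).
  by rewrite ltr_wpDr // sumr_ge0.
exists [seq l + (1 + \sum_(l <- s) `|l|) | l <- s]; first exact: eigs_shift.
apply/allP => _ /mapP[l ls ->] /=; rewrite (big_rem l ls) /=.
have : 0 <= \sum_(k <- rem l s) `|k| by apply: sumr_ge0.
have := ler_norm (- l); rewrite normrN; lra.
Qed.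

(** A zero eigenvalue contributes C on both sides; any other satisfies C + T l <= T (C + l). Only
    nonzero eigenvalues cost a factor T. *)
Lemma prod_growth (s : seq R) (C T : R) : 0 <= C -> 1 <= T -> all (>= 0) s ->
  0 <= \prod_(l <- s) (C + T * l) <= T ^+ count (predC1 0) s * \prod_(l <- s) (C + l).
Proof.
move=> C0 T1; elim: s => [|l s IH] /=; first by rewrite !big_nil mulr1 ler01 lexx.
move=> /andP[l0 /IH /andP[P0 le]]; rewrite !big_cons.
have f0 : 0 <= C + T * l by rewrite addr_ge0 // mulr_ge0 //; lra.
rewrite mulr_ge0 //= exprD mulrACA; apply: ler_pM => //.
by have [->|l_neq0] := eqVneq l 0; rewrite /= ?expr0 ?expr1; nra.
Qed.

End Bounds.

(** * Positivity of the mixed form and ranks of partial sums *)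

Theorem theorem2p2 (R : realType) (m n : nat) (p : {mpoly R[m]})
    (e : 'rV[R]_m) (x : 'I_n -> 'rV[R]_m)
    (p_homog : p \is n.-homog)
    (p_hyp : hyperbolic n p e)
    (pe_gt0 : 0 < p.@[e ord0])
    (x_nonneg : forall i : 'I_n, e_nonnegative n p e (x i)) :
  0 < mixed_form p x <->
  forall S : {set 'I_n}, (#|S| <= p_rank n p e (\sum_(i in S) x i)%R)%N.
Proof.
have he : hyp n p e by apply: hyperbolic_hyp.
have hx i : enneg n p e (x i) by apply: e_nonnegative_enneg.
pose lam (S : {set 'I_n}) := roots_mult (line_poly p e (\sum_(i in S) x i)).
have hlam (S : {set 'I_n}) : eigs n p e (\sum_(i in S) x i) (lam S).
  exact: roots_mult_eigs.
have dlam S : desc (lam S) by apply: roots_mult_desc.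
have lam0 S : all (>= 0) (lam S).
  have [s hs s0] := enneg_sum he (index_enum _) (fun i (_ : i \in S) => hx i).
  exact: (eigs_all he hs (hlam S) s0).
have rankE (S : {set 'I_n}) :
    p_rank n p e (\sum_(i in S) x i) = count (predC1 0) (lam S).
  exact: p_rank_count.
split=> [M0 S|rk].
  rewrite rankE leqNgt; apply/negP => lt; set r := count _ _ in lt.
  (* The vectors outside S have a fixed sum, dominated by C e. By monotonicity p of the weighted sum
     is then at most p (T sum_(i in S) x_i + C e), a product over the eigenvalues for S. *)
  have [C C0 dom] := dominate he (- \sum_(i in ~: S) x i).
  set B := pval p e * \prod_(l <- lam S) (C + l).
  (* Comparing T^|S| with T^r, where r + 1 <= |S|, leaves a bound on M_p T that is uniform in T. *)
  have key T : 1 <= T -> mixed_form p x * T <= B.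
    move=> T1; have T0 : 0 < T by lra.
    pose al i := if i \in S then T else 1.
    have al0 i : 0 < al i by rewrite /al; case: ifP.
    have := mixed_form_le he hx al0.
    have -> : \prod_i al i = T ^+ #|S|.
      by rewrite /al -big_mkcond prodr_const.
    have -> : \sum_i al i *: x i = T *: (\sum_(i in S) x i) + \sum_(i in ~: S) x i.
      rewrite scaler_sumr [in RHS]big_mkcond [X in _ = _ + X]big_mkcond.
      rewrite -big_split; apply: eq_bigr => i _ /=; rewrite /al inE.
      by case: ifP => _ /=; rewrite ?addr0 ?add0r ?scale1r.
    set v := _ + _ => le1.
    have nv : enneg n p e v.
      apply: (ennegD he); first apply: (ennegZ he); rewrite ?ltW //.
        exact: (enneg_sum he).
      exact: (enneg_sum he).
    have := pval_mono he nv dom; rewrite /v addrA addrK => le2.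
    have [_ hT] := eigs_scale p_homog T0 (hlam S).
    rewrite hT big_map in le2.
    have /andP[_ le3] := prod_growth (ltW C0) T1 (lam0 S).
    have le4 : mixed_form p x * T ^+ #|S| <= T ^+ r * B.
      apply: le_trans le1 _; apply: le_trans le2 _.
      by rewrite /B mulrCA ler_wpM2l // ltW // (hyp_gt0 he).
    have : mixed_form p x * T ^+ r.+1 <= T ^+ r * B.
      by apply: le_trans le4; rewrite ler_wpM2l ?(ltW M0) // ler_weXn2l.
    by rewrite exprS mulrA [leRHS]mulrC ler_pM2r // exprn_gt0.
  have B0 : 0 <= B.
    rewrite /B mulr_ge0 ?(ltW (hyp_gt0 he)) // big_seq prodr_ge0 // => l.
    by move=> /(allP (lam0 S)) /= l0; rewrite addr_ge0 // ltW.
  (* For this T the bound [key] reads M_p + B <= B, contradicting M_p > 0. *)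
  have T1 : 1 <= 1 + B / mixed_form p x by rewrite lerDl divr_ge0 // ltW.
  have := key _ T1; rewrite mulrDr mulr1 mulrCA divff ?gt_eqF // mulr1; lra.
(* The eigenvalues are nonnegative, so the rank counts the positive ones; in decreasing order the
   first |S| of them are positive. *)
have posk (S : {set 'I_n}) k : (k < #|S|)%N -> 0 < nth 0 (lam S) k.
  move=> kS; have [sn _] := hlam S.
  have kn : (k < n)%N.
    by rewrite (leq_trans kS) // -[leqRHS]card_ord max_card.
  rewrite desc_count ?sn //; apply: leq_trans kS _; apply: leq_trans (rk S) _.
  rewrite rankE (@eq_in_count _ _ (> 0)) // => l /(allP (lam0 S)) /= l0.
  by rewrite lt_neqAle l0 andbT eq_sym.
(* The default 1 for k >= |S| keeps this finite family positive, so one kap > 0 lies below all the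
   eigenvalues concerned. *)
pose g (z : {set 'I_n} * 'I_n) :=
  if (z.2 < #|z.1|)%N then nth 0 (lam z.1) z.2 else 1.
pose gs := [seq g z | z <- enum {: {set 'I_n} * 'I_n}].
have [|kap kap0 hkap] := @seq_gt_margin R gs.
  by apply/allP => _ /mapP[z _ ->] /=; rewrite /g; case: ifP => // /posk.
have kapP (S : {set 'I_n}) k : (k < #|S|)%N -> kap <= nth 0 (lam S) k.
  move=> kS; have kn : (k < n)%N.
    by rewrite (leq_trans kS) // -[leqRHS]card_ord max_card.
  have /(allP hkap) : g (S, Ordinal kn) \in gs.
    by apply: map_f; rewrite mem_enum.
  by rewrite /g /= kS => /ltW.
have le := mixed_form_ge he hx
  (fun al => pval_comb_ge he hx (al := al) (ltW kap0) hlam dlam kapP).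
have : 0 < capK R n * mixed_form p x.
  by apply: lt_le_trans le; rewrite mulr_gt0 ?(hyp_gt0 he) // exprn_gt0.
by rewrite pmulr_rgt0 ?capK_gt0.
Qed.
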